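(* Let $(\mathbb{E},d)$ be a complete metric space and let $p,q,r\ge1$ be real numbers with $\frac1p=\frac1q+\frac1r$. Let $f\in\mathbb{S}^p\mathrm{AP}(\mathbb{R}\times\mathbb{E},\mathbb{E})$, and assume that there exists a nonnegative function $L\in\mathbb{S}^r(\mathbb{R})$ such that $$d(f(t,u),f(t,v))\le L(t)\,d(u,v)\qquad\text{for all }t\in\mathbb{R},\ u,v\in\mathbb{E}.$$ Then, for every $u\in\mathbb{S}^q\mathrm{AP}(\mathbb{R},\mathbb{E})$, the function $t\mapsto f(t,u(t))$ belongs to $\mathbb{S}^p\mathrm{AP}(\mathbb{R},\mathbb{E})$.
   Context: A measurable $f:\mathbb{R}\to\mathbb{E}$ is locally $p$-integrable if, for some (equivalently any) fixed $x_0\in\mathbb{E}$, $\int_a^b d^p(f(t),x_0)\,dt<\infty$ for all $a<b$; functions equal Lebesgue-a.e. are identified. For locally $p$-integrable $f,g$, $D_{\mathbb{S}^p}^d(f,g)=\sup_{x\in\mathbb{R}}\bigl(\int_x^{x+1}d^p(f(t),g(t))\,dt\bigr)^{1/p}$. A set $T\subset\mathbb{R}$ is relatively dense if there is $\ell>0$ with $T\cap[a,a+\ell]\neq\emptyset$ for all $a\in\mathbb{R}$. $\mathbb{S}^p\mathrm{AP}(\mathbb{R},\mathbb{E})$ is the set of locally $p$-integrable $f:\mathbb{R}\to\mathbb{E}$ such that for every $\varepsilon>0$ the set $\{\tau\in\mathbb{R}: D^d_{\mathbb{S}^p}(f(\cdot+\tau),f(\cdot))\le\varepsilon\}$ is relatively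 dense. $\mathbb{S}^p\mathrm{AP}(\mathbb{R}\times\mathbb{E},\mathbb{E})$ is the set of measurable $f:\mathbb{R}\times\mathbb{E}\to\mathbb{E}$ such that $f(\cdot,x)\in\mathbb{S}^p\mathrm{AP}(\mathbb{R},\mathbb{E})$ for every $x\in\mathbb{E}$. $\mathbb{S}^r(\mathbb{R})$ is the set of measurable $L:\mathbb{R}\to\mathbb{R}$ with $\sup_{x\in\mathbb{R}}\bigl(\int_x^{x+1}|L(t)|^r\,dt\bigr)^{1/r}<\infty$. *)

(* Defs.v *)
From HB Require Import structures.
From mathcomp Require Import all_boot all_order all_algebra.
From mathcomp Require Import all_classical all_reals all_analysis.
Set Implicit Arguments.
Unset Strict Implicit.
Unset Printing Implicit Defensive.
Import Order.TTheory GRing.Theory Num.Theory.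
Import numFieldNormedType.Exports.
Local Open Scope classical_set_scope.
Local Open Scope ring_scope.

(* The library bundles completeness with (pointed) pseudometrics only. *)
#[short(type="completeMetricType")]
HB.structure Definition CompleteMetric (R : numDomainType) :=
  {M of CompletePseudoMetric R M & Metric R M}.

(* The real line with the Lebesgue-measurable sets, the domain of
   completed_lebesgue_measure; the canonical sigma-algebra of R is the Borel
   one. *)
Notation lebesgueR R :=
  (caratheodory_type (wlength (@idfun R))^*%mu) (only parsing).

Notation borel E := (g_sigma_algebraType (@open E)) (only parsing).

Definition lebesgue_measurable (R : realType) d (T : measurableType d)
    (f : R -> T) : Prop :=
  @measurable_fun _ d (lebesgueR R) T setT f.

Section Stepanov.
Context {R : realType}.
Local Notation mu := (@completed_lebesgue_measure R).

Section metric_valued.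
Context {E : completeMetricType R}.
Implicit Types (f g : R -> E) (p : R).

Definition locally_integrable_pow p f : Prop :=
  lebesgue_measurable (f : R -> borel E) /\
  exists x0 : E, forall a b : R, a < b ->
    (\int[mu]_(t in `[a, b]) (mdist (f t) x0 `^ p)%:E < +oo)%E.

Definition stepanov_dist p f g : \bar R :=
  ereal_sup [set poweR
    (\int[mu]_(t in `[x, (x + 1)%R]) (mdist (f t) (g t) `^ p)%:E)%E p^-1
    | x in [set: R]].

Definition relatively_dense (T : set R) : Prop :=
  exists2 l : R, 0 < l & forall a : R, T `&` `[a, a + l] !=set0.

Definition stepanov_ap p f : Prop :=
  locally_integrable_pow p f /\
  forall eps : R, 0 < eps ->
    relatively_dense
      [set tau | (stepanov_dist p (fun t => f (t + tau)%R) f <= eps%:E)%E].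

(* Measurability refers to the product of the Lebesgue sigma-algebra of R and
   the Borel sigma-algebra of E, hence covers Borel functions on R * E. *)
Definition stepanov_ap_param p (f : R * E -> E) : Prop :=
  @measurable_fun _ _ (lebesgueR R * borel E)%type (borel E) setT f /\
  forall x : E, stepanov_ap p (fun t => f (t, x)).

End metric_valued.

Definition stepanov_bounded (r : R) (L : R -> R) : Prop :=
  lebesgue_measurable L /\
  (ereal_sup [set poweR
     (\int[mu]_(t in `[x, (x + 1)%R]) (`|L t| `^ r)%:E)%E r^-1
     | x in [set: R]] < +oo)%E.

End Stepanov.

(* Main.v *)
Require Import Defs.
From mathcomp Require Import all_boot all_order all_algebra.
From mathcomp Require Import all_classical all_reals all_analysis.
From mathcomp Require Import measurable_realfun wochoice ring lra.

(** Why the theorem holds. Let v(t) = f(t, u(t)), and fix c > 0. For any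
    point x_i of E,

      d(v(t+tau), v(t)) <= d(f(t+tau, u(t+tau)), f(t+tau, x_i))
                           + d(f(t+tau, x_i), f(t, x_i)) + d(f(t, x_i), f(t, u(t)))

    so that, choosing at each t the x_i nearest to u(t) among x_0, ..., x_n and
    writing m(t) for that smallest distance,

      d(v(t+tau), v(t)) <= L(t+tau) (d(u(t+tau), u(t)) + m(t)) + L(t) m(t)
                           + d(f(t+tau, x_i), f(t, x_i)).

    Young's inequality turns (L a)^p into lambda^r L^r + lambda^-q a^q; a small
    lambda makes the L^r part small on every unit segment. What remains is small
    as soon as m is small in S^q, and tau is an almost period common to u and to
    the finitely many functions f(., x_i). Three facts are therefore needed.

    - Finite nets (uniform_net): some x_0, ..., x_n make the integrals of m^q over
      all unit segments small. By almost periodicity it is enough to treat one long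
      segment, where dominated convergence applies to a sequence x that is dense in
      the essential range of u.

    - Common almost periods (bohr_familyI_dense): this is Bohr's pigeonhole
      argument. It requires small translations to be almost periods, which
      almost_period_near0 deduces from the L^1 continuity of translations applied
      to the real functions d(u(.), x_j)^p, again through finite nets.

    - Essential separability (ess_separable): a Lebesgue measurable u : R -> E
      takes almost all its values in a separable set, although E itself need not
      be separable. Besides providing the sequence x, this makes
      t |-> d(u(t), v(t)) measurable for measurable u and v (measurable_mdist).

    Essential separability is the delicate point. A discreteness argument of Stone
    reduces it to the following: a map h defined on a set N of finite measure, all
    of whose preimages are measurable and all of whose fibers are null, can only
    exist when N is null (null_of_all_preimages_measurable). Indeed, composing h
    with its distribution function, one may assume that the preimage of a set has at
    most the outer measure of that set (mu_fiber_cdf_le). Cut the line into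
    countably many rational translates V_q of a Vitali set. If the preimage of V_q
    had positive measure, Lusin's theorem would give in it a compact set of positive measure
    with compact image inside V_q; but compact subsets of V_q are null, since they
    have infinitely many disjoint translates in a bounded region, and hence so are
    their preimages.

    Everything is expressed with p-th powers of distances rather than with norms:
    the inequality (a + b)^p <= 2^p (a^p + b^p) replaces Minkowski's inequality, as
    only smallness matters. *)

Import Order.TTheory GRing.Theory Num.Theory.
Import numFieldNormedType.Exports.
Local Open Scope ring_scope.

(** * The completed Lebesgue measure *)

Section lebesgue.
Context {R : realType}.
Local Open Scope classical_set_scope.
Local Open Scope ring_scope.
Local Notation mu := (@completed_lebesgue_measure R).
Local Notation lam := (@lebesgue_measure R).
Local Notation len := (wlength (@idfun R)).
Implicit Types (A B : set R) (c : R).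

(** Shifting every interval of a cover gives a cover of the shifted set with the same
    total length. Stated for the outer measure, it also gives the measurability of shifts. *)
Lemma mu_ext_shift_le A c :
  (len^*%mu ((fun t : R => (t + c)%R) @^-1` A) <= len^*%mu A)%E.
Proof.
apply: ereal_inf_le_tmp => _ [F [mF AF] <-].
pose G k : set (ocitv_type R) := (fun t : R => (t + c)%R) @^-1` (F k).
exists G; first split.
- move=> k; have [[a b] _ abF] := mF k.
  exists (a - c, b - c) => //=; rewrite /G -abF.
  apply/seteqP; split => t /=; rewrite !in_itv /=; lra.
- by move=> t At; have [k _ Fk] := AF _ At; exists k.
apply: eq_eseriesr => k _; have /ocitvP := mF k.
rewrite /G => -[->|[[a b] /= ab ->]].
  by rewrite preimage_set0.
rewrite (_ : _ @^-1` _ = `]a - c, b - c]%classic); last first.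
  by apply/seteqP; split => t /=; rewrite !in_itv /=; lra.
rewrite !wlength_itv /= !lte_fin ltrD2r ab -!EFinB; congr (_%:E); lra.
Qed.

Lemma mu_ext_shift A c :
  len^*%mu ((fun t : R => (t + c)%R) @^-1` A) = len^*%mu A.
Proof.
apply/le_anti/andP; split; first exact: mu_ext_shift_le.
have := mu_ext_shift_le ((fun t : R => (t + c)%R) @^-1` A) (- c).
rewrite -comp_preimage (_ : (fun t : R => (t + c)%R) \o _ = id) //.
by apply/funext => t /=; rewrite addrNK.
Qed.

Lemma measurable_shift c :
  @measurable_fun _ _ (lebesgueR R) (lebesgueR R) setT (fun t : R => (t + c)%R).
Proof.
move=> _ A mA; rewrite setTI.
have {}mA : caratheodory_measurable len^*%mu A by [].
suff : caratheodory_measurable len^*%mu ((fun t : R => (t + c)%R) @^-1` A) by [].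
move=> X.
have E B : B = (fun t : R => (t + c)%R) @^-1` ((fun t : R => (t - c)%R) @^-1` B).
  by apply/seteqP; split => t /=; rewrite addrK.
rewrite {1}(E X) mu_ext_shift mA -(mu_ext_shift _ c).
rewrite -(mu_ext_shift (_ `&` ~` _) c).
by rewrite !preimage_setI -!E.
Qed.

Lemma pushforward_shift c : pushforward mu (fun t : R => (t + c)%R) = mu.
Proof. by apply/funext => A; rewrite /pushforward; exact: mu_ext_shift. Qed.

Lemma measurable_lebesgueR A : measurable A -> measurable (A : set (lebesgueR R)).
Proof. exact: sub_caratheodory. Qed.

Lemma lebesgueR_itv (i : interval R) : measurable ([set` i] : set (lebesgueR R)).
Proof. by apply: measurable_lebesgueR; exact: measurable_itv. Qed.

Lemma ge0_integral_shift (a b c : R) (F : R -> \bar R) :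
  lebesgue_measurable F -> (forall t, (0 <= F t)%E) ->
  (\int[mu]_(t in `[a, b]) F (t + c)%R = \int[mu]_(t in `[(a + c)%R, (b + c)%R]) F t)%E.
Proof.
move=> mF F0.
have -> : `[a, b]%classic = (fun t : R => (t + c)%R) @^-1` `[(a + c)%R, (b + c)%R]%classic.
  by apply/seteqP; split => t /=; rewrite !in_itv /=; lra.
rewrite -[in RHS](pushforward_shift c).
rewrite (@ge0_integral_pushforward _ _ (lebesgueR R) (lebesgueR R) _ _
  (measurable_shift c) mu) //; first exact: lebesgueR_itv.
exact: measurable_funTS.
Qed.

(** The outer measure that underlies both Lebesgue measures is defined on all sets, and
    a set is negligible exactly when its outer measure vanishes; nullity of arbitrary
    sets can thus be written as an equation. *)
Lemma null_lebesgueR A : mu A = 0%E -> measurable (A : set (lebesgueR R)).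
Proof.
move=> A0.
have /negligible_outer_measure[B [mB B0 AB]] : ((wlength idfun)^*)%mu A = 0%E.
  exact: A0.
apply: completed_lebesgue_measure_is_complete.
exists B; split => //; exact: measurable_lebesgueR.
Qed.

Lemma mu_ge0 A : (0 <= mu A)%E. Proof. exact: outer_measure_ge0. Qed.

Lemma le_mu A B : A `<=` B -> (mu A <= mu B)%E.
Proof. by move=> AB; exact: (le_outer_measure len^*%mu). Qed.

Lemma null_subset A B : A `<=` B -> mu B = 0%E -> mu A = 0%E.
Proof.
move=> AB B0; apply/eqP; rewrite eq_le; apply/andP; split; last exact: mu_ge0.
by rewrite -B0; exact: le_mu.
Qed.

Lemma null_bigcup (I : countType) (F : I -> set R) :
  (forall i, mu (F i) = 0%E) -> mu (\bigcup_i F i) = 0%E.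
Proof.
move=> F0; pose G n := if unpickle n is Some i then F i else set0.
have G0 n : mu (G n) = 0%E by rewrite /G; case: unpickle.
apply: (@null_subset _ (\bigcup_n G n)).
  by move=> t [i _ Fi]; exists (pickle i) => //; rewrite /G pickleK.
apply/eqP; rewrite eq_le; apply/andP; split; last exact: outer_measure_ge0.
apply: le_trans (outer_measure_sigma_subadditive _ _) _.
by rewrite eseries0 // => n _ _; exact: G0.
Qed.

Lemma lebesgueR_borel A : measurable (A : set (lebesgueR R)) ->
  exists B N : set R, [/\ measurable B, measurable N, lam N = 0%E, B `<=` A & A `\` B `<=` N].
Proof.
move=> mA.
have : ((wlength (@idfun R))^*%mu.-cara.-measurable) A by [].
rewrite -completed_caratheodory_measurable g_sigma_completed_algebra_genE.
case=> /= B mB [M negM <-{A mA}].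
case: negM => N [mN N0 MN].
exists B, N; split; [exact: mB|exact: mN|exact: N0|by move=> x; left|].
by move=> x [[|/MN]].
Qed.

(** Bridge to the results known for Borel functions: the sets where g exceeds a rational
    are Borel up to null sets, and g becomes Borel once the union of these countably
    many null sets is removed. *)
Lemma lebesgue_measurable_borel (g : R -> R) : lebesgue_measurable g ->
  exists (N : set R) (g' : R -> R), [/\ measurable N, lam N = 0%E, measurable_fun setT g' &
    forall t, ~ N t -> g t = g' t].
Proof.
move=> mg.
(* For each rational q, a Borel set below the set where g exceeds q. *)
have mgq (q : rat) : measurable ([set t | ratr q < g t] : set (lebesgueR R)).
  have := mg measurableT `]ratr q, +oo[%classic (measurable_itv _).
  rewrite setTI; congr measurable; apply/seteqP.
  by split => t /=; rewrite in_itv /= andbT.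
have [B /choice[N BN]] := choice (fun q => lebesgueR_borel _ (mgq q)).
have mN : measurable (\bigcup_q N q).
  by apply: bigcupT_measurable_rat => q; have [] := BN q.
(* Where g is modified, its value 0 must be compared with the level r: hence the
   term depending on the sign of r below. *)
exists (\bigcup_q N q), (fun t => if t \in \bigcup_q N q then 0 else g t); split => //.
- by apply: null_bigcup => q; have [] := BN q.
- apply: (measurability _ (RGenOInfty.measurableE R)) => _ [_ [r ->] <-].
  rewrite setTI.
  rewrite (_ : _ @^-1` _ = ((\bigcup_(q in [set q : rat | r < ratr q]) B q) `\` (\bigcup_q N q))
    `|` (if r < 0 then \bigcup_q N q else set0)).
    apply: measurableU; last by case: ifP.
    apply: measurableD => //.
    rewrite bigcup_mkcond; apply: bigcupT_measurable_rat => q; by case: ifP => // _; have [] := BN q.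
  apply/seteqP; split => t /=; rewrite in_itv /= andbT.
    case: ifPn => [/set_mem Nt r0|/negP tN rg]; first by right; rewrite r0.
    left; split; last by move=> Nt; apply: tN; exact/mem_set.
    have [q] := rat_in_itvoo rg; rewrite in_itv /= => /andP[rq qg].
    exists q => //; apply: contrapT => Bt; apply: tN; apply/mem_set.
    by exists q => //; have [_ _ _ _] := BN q; apply.
  case=> [[[q /= rq Bt] Nt]|].
    rewrite ifN; last by apply/negP => /set_mem.
    by apply: (lt_trans rq); have [_ _ _ /(_ _ Bt)] := BN q.
  by case: ifPn => // r0 Nt; rewrite ifT //; exact/mem_set.
- by move=> t Nt; rewrite ifN //; apply/negP => /set_mem.
Qed.
Implicit Types k l : R -> R.

Lemma lebesgue_measurable_cst c : lebesgue_measurable (fun _ : R => c).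
Proof. exact: (@measurable_cst _ _ (lebesgueR R) R). Qed.

Lemma lebesgue_measurableD k l : lebesgue_measurable k -> lebesgue_measurable l ->
  lebesgue_measurable (fun t => k t + l t).
Proof. exact: (@measurable_funD _ (lebesgueR R) R setT). Qed.

Lemma lebesgue_measurableM k l : lebesgue_measurable k -> lebesgue_measurable l ->
  lebesgue_measurable (fun t => k t * l t).
Proof. exact: (@measurable_funM _ (lebesgueR R) R setT). Qed.

Lemma lebesgue_measurable_min k l : lebesgue_measurable k -> lebesgue_measurable l ->
  lebesgue_measurable (fun t => Num.min (k t) (l t)).
Proof. exact: (@measurable_minr _ (lebesgueR R) R setT). Qed.

Lemma lebesgue_measurable_dist k l : lebesgue_measurable k -> lebesgue_measurable l ->
  lebesgue_measurable (fun t => `|k t - l t|).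
Proof.
move=> mk ml.
have mB := @measurable_funB _ (lebesgueR R) R setT _ _ mk ml.
exact: (@measurableT_comp _ _ _ (lebesgueR R) R R _ _ _ (@normr_measurable R setT) mB).
Qed.

Lemma lebesgue_measurable_pow p k : lebesgue_measurable k ->
  lebesgue_measurable (fun t => k t `^ p).
Proof.
by move=> mk; exact: (@measurableT_comp _ _ _ (lebesgueR R) R R _ _ _ (measurable_powR p) mk).
Qed.

Lemma lebesgue_measurable_shift d (T : measurableType d) (k : R -> T) s :
  lebesgue_measurable k -> lebesgue_measurable (fun t => k (t + s)).
Proof.
move=> mk; exact: (@measurableT_comp _ _ _ (lebesgueR R) (lebesgueR R) T _ _ _ mk
  (measurable_shift s)).
Qed.

End lebesgue.

(** * Integrals of nonnegative functions over segments *)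

Section segment_integrals.
Context {R : realType}.
Local Open Scope classical_set_scope.
Local Open Scope ring_scope.
Local Notation mu := (@completed_lebesgue_measure R).
Local Notation lam := (@lebesgue_measure R).
Implicit Types (a b c s : R) (k l : R -> R).

Definition segint a b k : \bar R := (\int[mu]_(t in `[a, b]) (k t)%:E)%E.

Let measE D k : lebesgue_measurable k ->
  @measurable_fun _ _ (lebesgueR R) _ D (fun t => (k t)%:E).
Proof. by move=> mk; apply/measurable_EFinP; exact: measurable_funTS. Qed.

Lemma le_segint a b k l : lebesgue_measurable k -> lebesgue_measurable l ->
  (forall t, 0 <= k t) -> (forall t, a <= t <= b -> k t <= l t) ->
  (segint a b k <= segint a b l)%E.
Proof.
move=> mk ml k0 kl; apply: ge0_le_integral.
- exact: lebesgueR_itv.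
- by move=> t _; rewrite lee_fin.
- exact: measE.
- exact: measE.
- by move=> t; rewrite /= in_itv /= => abt; rewrite lee_fin kl.
Qed.

Lemma eq_segint_le a b k l (c : \bar R) : k =1 l ->
  (segint a b k <= c)%E -> (segint a b l <= c)%E.
Proof. by move=> /funext ->. Qed.

Lemma segintD a b k l : lebesgue_measurable k -> lebesgue_measurable l ->
  (forall t, 0 <= k t) -> (forall t, 0 <= l t) ->
  segint a b (fun t => k t + l t) = (segint a b k + segint a b l)%E.
Proof.
move=> mk ml k0 l0.
apply: (@ge0_integralD _ (lebesgueR R) R mu _ (lebesgueR_itv `[a, b])
  (fun t => (k t)%:E) (fun t => (l t)%:E)).
- by move=> t _; rewrite lee_fin.
- exact: measE.
- by move=> t _; rewrite lee_fin.
- exact: measE.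
Qed.

Lemma segintZ a b c k : lebesgue_measurable k -> 0 <= c ->
  (forall t, 0 <= k t) ->
  segint a b (fun t => c * k t) = (c%:E * segint a b k)%E.
Proof.
move=> mk c0 k0.
apply: (@ge0_integralZl_EFin _ (lebesgueR R) R mu _ (lebesgueR_itv `[a, b])
  (fun t => (k t)%:E)) => //.
- by move=> t _; rewrite lee_fin.
- exact: measE.
Qed.

Lemma segint_ge0 a b k : (forall t, 0 <= k t) -> (0 <= segint a b k)%E.
Proof. by move=> k0; apply: integral_ge0 => t _; rewrite lee_fin. Qed.

Lemma segint_shift a b c k : lebesgue_measurable k -> (forall t, 0 <= k t) ->
  segint a b (fun t => k (t + c)) = segint (a + c) (b + c) k.
Proof.
move=> mk k0; rewrite /segint -(@ge0_integral_shift _ _ _ _ (fun t => (k t)%:E)) //.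
exact: measE.
Qed.

Lemma segintS a b a' b' k : lebesgue_measurable k -> (forall t, 0 <= k t) ->
  a' <= a -> b <= b' -> (segint a b k <= segint a' b' k)%E.
Proof.
move=> mk k0 a'a bb'; apply: ge0_subset_integral.
- exact: lebesgueR_itv.
- exact: lebesgueR_itv.
- exact: measE.
- by move=> t _; rewrite lee_fin.
- by move=> t /=; rewrite !in_itv /= => /andP[at_ tb]; apply/andP; split; lra.
Qed.

Lemma segint_cst a b c : a <= b -> segint a b (fun=> c) = (c * (b - a))%:E.
Proof.
move=> ab; rewrite /segint integral_cst; last exact: lebesgueR_itv.
transitivity (c%:E * lam `[a, b]%classic)%E; first by [].
rewrite lebesgue_measure_itv /= lte_fin.
by case: ltgtP ab => // -> _; rewrite subrr mulr0 mule0.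
Qed.

(** The identity is measurable from the completed to the Borel structure and pushes the
    completed measure to the Borel one. *)
Lemma segint_borel a b k k' : lebesgue_measurable k -> measurable_fun setT k' ->
  (forall t, 0 <= k t) -> (forall t, 0 <= k' t) ->
  (exists N : set R, [/\ measurable N, lam N = 0%E & forall t, ~ N t -> k t = k' t]) ->
  segint a b k = (\int[lam]_(t in `[a, b]) (k' t)%:E)%E.
Proof.
move=> mk mk' k0 k'0 [N [mN N0 kk']].
have mid : @measurable_fun _ _ (lebesgueR R) R setT idfun.
  by move=> _ A mA; rewrite setTI; exact: measurable_lebesgueR.
transitivity (\int[mu]_(t in `[a, b]) (k' t)%:E)%E; last first.
  have := @ge0_integral_pushforward _ _ (lebesgueR R) (measurableTypeR R) _ _ mid mu
    `[a, b]%classic (fun t => (k' t)%:E) (measurable_itv _).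
  move=> E; apply/esym/E; last by move=> t _; rewrite lee_fin.
  by apply/measurable_EFinP; exact: measurable_funTS.
have mk'_ : lebesgue_measurable k' by exact: measurableT_comp mk' mid.
apply: ge0_ae_eq_integral.
- exact: lebesgueR_itv.
- exact: measE.
- exact: measE.
- by move=> t _; rewrite lee_fin.
- by move=> t _; rewrite lee_fin.
exists N; split; [exact: measurable_lebesgueR|exact: N0|].
move=> t /= /not_implyP[_ kt]; apply: contrapT => /kk' E; apply: kt.
by rewrite E.
Qed.

Lemma uniformly_continuous_segment (g : R -> R) a b (e : R) : continuous g -> 0 < e ->
  exists2 d, 0 < d & forall s t, `|s| <= d -> a <= t <= b -> `|g (t + s) - g t| <= e.
Proof.
move=> cg e0.
have cab : compact `[a, b]%classic := @segment_compact _ a b.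
move/compact_near_coveringP in cab.
have := cab _ (nbhs (0 : R)) (fun s t => `|g (t + s) - g t| <= e) _.
case.
- move=> t _.
  have e20 : 0 < e / 2 by lra.
  have /cvgrPdist_le/(_ _ e20)/nbhs_ballP[d /= d0 dg] := cg t.
  exists (ball t (d / 2), ball 0 (d / 2)).
    by split; apply: nbhsx_ballx; lra.
  move=> [t' s] [] /=; rewrite /ball /= sub0r normrN => tt' sd.
  have h1 : `|g t - g t'| <= e / 2.
    by apply: dg; rewrite /ball /=; lra.
  have h2 : `|g t - g (t' + s)| <= e / 2.
    apply: dg; rewrite /ball /= opprD addrA.
    by rewrite (le_lt_trans (ler_normB _ _)) //; lra.
  rewrite (_ : _ - _ = (g t - g t') - (g t - g (t' + s))); last by lra.
  by rewrite (le_trans (ler_normB _ _)) //; lra.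
- move=> d /= d0 dP; exists (d / 2); first by lra.
  move=> s t sd tab; apply: (dP s) => /=; last by rewrite in_itv.
  by rewrite sub0r normrN; lra.
Qed.

Lemma cvge0_lt (x : nat -> \bar R) (e : R) : x @ \oo --> 0%E -> 0 < e ->
  exists n, (x n < e%:E)%E.
Proof.
move=> /fine_cvgP[xfin /cvgrPdist_lt x0] e0.
near \oo => n; exists n.
have xn : x n \is a fin_num by near: n.
rewrite -(fineK xn) lte_fin (le_lt_trans (ler_norm _)) //.
rewrite -normrN -sub0r; near: n; exact: x0.
Unshelve. all: by end_near. Qed.

(** Approximation in L^1 by a continuous function, which is uniformly continuous on the
    segment. The unit margins keep t + s inside the segment where k is integrable. *)
Lemma translation_continuous_L1 (k : R -> R) a b (e : R) :
  lebesgue_measurable k -> (forall t, 0 <= k t) -> a <= b ->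
  (segint (a - 1) (b + 1) k < +oo)%E -> 0 < e ->
  exists2 d, 0 < d & forall s, `|s| <= d ->
    (segint a b (fun t => `|k (t + s)%R - k t|%R) <= e%:E)%E.
Proof.
move=> mk k0 ab kfin e0.
have [N [k' [mN N0 mk' kk']]] := lebesgue_measurable_borel _ mk.
pose I := `[a - 1, b + 1]%classic : set (measurableTypeR R).
have mI : measurable I by exact: measurable_itv.
have ik' : lam.-integrable I (EFin \o k').
  apply/integrableP; split; first by apply/measurable_EFinP; exact: measurable_funTS.
  move: kfin; rewrite (@segint_borel _ _ _ (fun t => `|k' t|)) //.
  - exact: measurableT_comp.
  - exists N; split => // t Nt; rewrite -kk' // ger0_norm //.
have Ifin : (lam I < +oo)%E.
  by rewrite /I /= lebesgue_measure_itv /=; case: ifP; rewrite ?ltry.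
have [g [cg ig /cvge0_lt gk']] :=
  @approximation_continuous_integrable R I k' mI Ifin ik'.
have [n {}gk'] := gk' (e / 4) ltac:(lra).
move: (g n) (cg n) gk' => {ig cg}g cg gk'.
have mg : measurable_fun setT g by exact: continuous_measurable_fun.
have mid : @measurable_fun _ _ (lebesgueR R) R setT idfun.
  by move=> _ A mA; rewrite setTI; exact: measurable_lebesgueR.
have mg_ : lebesgue_measurable g by exact: measurableT_comp mg mid.
have mkg : lebesgue_measurable (fun t => `|k t - g t|).
  exact: lebesgue_measurable_dist.
have {}gk' : (segint (a - 1) (b + 1) (fun t => `|k t - g t|%R) <= (e / 4)%:E)%E.
  rewrite (@segint_borel _ _ _ (fun t => `|k' t - g t|)) //.
  - exact: ltW.
  - by apply: measurableT_comp => //; exact: measurable_funB.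
  - by exists N; split => // t Nt; rewrite kk'.
have eb0 : 0 < e / (2 * (b - a + 1)) by rewrite divr_gt0 //; lra.
have [d d0 dg] := uniformly_continuous_segment g a b _ cg eb0.
(* s is at most 1 so that t + s remains within the unit margins. *)
exists (Num.min d 1); first by rewrite lt_min d0 ltr01.
move=> s; rewrite le_min => /andP[/dg {}dg s1].
have [s1' s1''] : - 1 <= s /\ s <= 1 by move: s1; rewrite ler_norml => /andP.
pose K1 t := `|k (t + s) - g (t + s)|; pose K2 t := `|k t - g t|.
have K10 t : 0 <= K1 t := normr_ge0 _.
have K20 t : 0 <= K2 t := normr_ge0 _.
have mK1 : lebesgue_measurable K1 by exact: lebesgue_measurable_shift mkg.
have mc (c : R) : lebesgue_measurable (fun _ : R => c) by exact: lebesgue_measurable_cst.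
apply: (@le_trans _ _ (segint a b (fun t => K1 t + (K2 t + e / (2 * (b - a + 1)))))).
  apply: le_segint => //.
  - by apply: lebesgue_measurable_dist => //; exact: lebesgue_measurable_shift.
  - by apply: lebesgue_measurableD => //; exact: lebesgue_measurableD.
  move=> t /dg {}dg; rewrite /K1 /K2.
  rewrite (_ : k (t + s) - k t = (k (t + s) - g (t + s)) - (k t - g t) + (g (t + s) - g t)); last by lra.
  rewrite (le_trans (ler_normD _ _)) // (addrA `|_| `|_|) lerD //.
  exact: ler_normB.
have mK2C : lebesgue_measurable (fun t => K2 t + e / (2 * (b - a + 1))).
  exact: lebesgue_measurableD.
have K2C0 t : 0 <= K2 t + e / (2 * (b - a + 1)).
  by apply: addr_ge0; [exact: normr_ge0|exact: ltW].
rewrite (segintD a b K1 (fun t => K2 t + e / (2 * (b - a + 1)))) //.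
rewrite (segintD a b K2 (fun=> e / (2 * (b - a + 1)))) //; last by move=> t; exact: ltW.
rewrite segint_cst // (segint_shift _ _ _ (fun t => `|k t - g t|)) //.
apply: (@le_trans _ _ ((e / 4)%:E + ((e / 4)%:E + (e / 2)%:E))%E); last first.
  by rewrite -!EFinD lee_fin; lra.
have sub a' b' : a - 1 <= a' -> b' <= b + 1 -> (segint a' b' K2 <= (e / 4)%:E)%E.
  by move=> aa' b'b; apply: le_trans gk'; apply: segintS => // t; exact: normr_ge0.
apply: leeD; first by apply: sub; lra.
apply: leeD; first by apply: sub; lra.
have -> : e / 2 = e / (2 * (b - a + 1)) * (b - a + 1) by field; lra.
by rewrite lee_fin ler_pM2l //; lra.
Qed.

End segment_integrals.

(** * Rational translates of a Vitali set *)

Section vitali.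
Context {R : realType}.
Local Open Scope classical_set_scope.
Local Open Scope ring_scope.
Local Notation mu := (@completed_lebesgue_measure R).
Local Notation lam := (@lebesgue_measure R).
Local Notation len := (wlength (@idfun R)).
Local Notation LM A := (measurable (A : set (lebesgueR R))).

(** The translates of K by 1/(n+1) are disjoint, have the same measure and stay in a
    bounded segment. *)
Lemma null_disjoint_translates (K : set R) (a b : R) : LM K -> K `<=` `[a, b] ->
  (forall (q : rat) x, K x -> K (x + ratr q) -> q = 0) -> mu K = 0%E.
Proof.
move=> mK Kab Kq.
have Kfin : (mu K <= (Num.max (b - a) 0)%:E)%E.
  apply: le_trans (le_mu _ _ Kab) _.
  rewrite -[leLHS]/(lam `[a, b]%classic) lebesgue_measure_itv /= lte_fin.
  by case: ifPn => _; rewrite lee_fin le_max lexx ?orbT.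
pose F (n : nat) : set R := (fun t : R => t + ratr (- (n.+1%:R)^-1)) @^-1` K.
have mF n : LM (F n).
  by have := measurable_shift (ratr (- (n.+1%:R)^-1)) measurableT _ mK; rewrite setTI.
have muF n : mu (F n) = mu K by exact: mu_ext_shift.
have tF : trivIset setT F.
  move=> m n _ _ [x [/= Km Kn]].
  have := Kq (- (n.+1%:R)^-1 + (m.+1%:R)^-1) _ Km.
  rewrite -addrA -rmorphD addrCA addNr addr0 => /(_ Kn)/eqP.
  rewrite addrC subr_eq0 => /eqP/invr_inj/eqP.
  by rewrite eqr_nat => /eqP[].
have UF : \bigcup_n F n `<=` `[a, b + 1].
  move=> x [n _ /Kab] /=; rewrite !in_itv /= rmorphN /= fmorphV /= ratr_nat.
  have : 0 < (n.+1%:R)^-1 :> R by rewrite invr_gt0.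
  have : (n.+1%:R)^-1 <= 1 :> R by rewrite invf_le1 // ler1n.
  by move: (_^-1) => y ? ? /andP[? ?]; apply/andP; split; lra.
have S : (\sum_(i <oo) mu K <= (Num.max (b + 1 - a) 0)%:E)%E.
  have <- : mu (\bigcup_n F n) = (\sum_(i <oo) mu K)%E.
    rewrite (@measure_bigcup _ (lebesgueR R) _ mu setT F) //.
    rewrite [RHS](_ : _ = \sum_(i <oo | i \in setT) mu K)%E; last first.
      by apply: eq_eseriesl => i; rewrite in_setT.
    by apply: eq_eseriesr => i _; exact: muF.
  apply: le_trans (le_mu _ _ UF) _.
  rewrite -[leLHS]/(lam `[a, b + 1]%classic) lebesgue_measure_itv /= lte_fin.
  by case: ifPn => _; rewrite lee_fin le_max lexx ?orbT.
have mu0 : (0 <= mu K)%E by exact: mu_ge0.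
have [c Kc] : exists c, mu K = c%:E.
  by exists (fine (mu K)); rewrite fineK // ge0_fin_numE // (le_lt_trans Kfin) ?ltry.
rewrite Kc in S mu0 *; rewrite lee_fin in mu0.
have Sn n : n%:R * c <= Num.max (b + 1 - a) 0.
  rewrite -lee_fin; apply: le_trans S.
  have := @nneseries_lim_ge R (fun=> c%:E) xpredT 0%N n (fun _ _ _ => mu0).
  by apply: le_trans; rewrite sumEFin big_const_nat subn0 iter_addr_0 mulr_natl.
congr (_%:E); apply/eqP; rewrite eq_le mu0 andbT leNgt; apply/negP => c0.
have := Sn (Num.truncn (Num.max (b + 1 - a) 0 / c)).+1.
rewrite leNgt => /negP; apply; rewrite -ltr_pdivrMr //.
exact: truncnS_gt.
Qed.

Let rat_equiv (x y : R) := exists q : rat, x - y = ratr q.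

Let rep (x : R) : R := xget 0 (rat_equiv x).

(** The translate by q of a set of representatives modulo the rationals. *)
Definition vitali_piece (q : rat) : set R := [set x | x = rep x + ratr q].

Lemma vitali_piece_cover : \bigcup_q vitali_piece q = setT.
Proof.
apply/seteqP; split => // x _.
have : rat_equiv x (rep x) by apply: (@xgetI _ _ _ x); exists 0; rewrite subrr rmorph0.
by case=> q xq; exists q => //; rewrite /vitali_piece /= -xq addrC subrK.
Qed.

Lemma vitali_piece_translate (q r : rat) (x : R) :
  vitali_piece q x -> vitali_piece q (x + ratr r) -> r = 0.
Proof.
have -> : vitali_piece q (x + ratr r) = (x + ratr r = rep x + ratr q).
  rewrite /vitali_piece /=; congr (_ = _ + _); rewrite /rep; congr (xget _ _).
  apply/seteqP; split => y [s xy].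
    by exists (s - r); rewrite rmorphB /= -xy; ring.
  by exists (s + r); rewrite rmorphD /= -xy; ring.
rewrite /vitali_piece /= => <- /eqP.
by rewrite -subr_eq0 addrC addKr fmorph_eq0 => /eqP.
Qed.

Lemma null_sub_vitali_piece (q : rat) (K : set R) : compact K ->
  K `<=` vitali_piece q -> mu K = 0%E.
Proof.
move=> cK KV.
have [M [_ KM]] := compact_bounded cK.
have {}KM : K `<=` `[- (M + 1), M + 1].
  move=> x Kx; have := KM (M + 1) _ x Kx; rewrite /= in_itv /= -ler_norml; apply; lra.
apply: null_disjoint_translates KM _.
  by apply: measurable_lebesgueR; exact: compact_measurable.
by move=> r x /KV Vx /KV; exact: vitali_piece_translate.
Qed.

End vitali.

(** * Maps all of whose preimages are Lebesgue measurable *)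

Section image_of_lebesgue.
Context {R : realType}.
Local Open Scope classical_set_scope.
Local Open Scope ring_scope.
Local Notation mu := (@completed_lebesgue_measure R).
Local Notation lam := (@lebesgue_measure R).
Local Notation len := (wlength (@idfun R)).
Local Notation LM A := (measurable (A : set (lebesgueR R))).
Local Notation low x := [set z : R | (z <= x)%R].
Local Notation high x := [set z : R | (x <= z)%R].
Implicit Types (A B N S D T : set R) (h : R -> R) (a b c x y : R).

Definition all_preimages_measurable {I : Type} N (h : R -> I) :=
  forall S : set I, LM (N `&` h @^-1` S).

Definition null_fibers {I : Type} N (h : R -> I) :=
  forall x : I, mu (N `&` h @^-1` [set x]) = 0%E.

(** Continuity from below, in the form needed to reach the supremum of a set. *)
Lemma mu_bigcup_le N h (y : nat -> R) (M : \bar R) : all_preimages_measurable N h ->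
  {homo y : m n / (m <= n)%N >-> m <= n} ->
  (forall n, (mu (N `&` h @^-1` low (y n)) <= M)%E) ->
  (mu (N `&` h @^-1` (\bigcup_n low (y n))) <= M)%E.
Proof.
move=> mNh yh yM.
pose F n : set R := N `&` h @^-1` low (y n).
have mF n : LM (F n) by exact: mNh.
have -> : N `&` h @^-1` (\bigcup_n low (y n)) = \bigcup_n F n.
  by rewrite preimage_bigcup setI_bigcupr.
have /cvg_lim <- // : mu \o F @ \oo --> mu (\bigcup_n F n).
  apply: (@nondecreasing_cvg_mu _ (lebesgueR R) _ mu) => //.
    exact: bigcupT_measurable.
  move=> m n mn; apply/subsetPset => x [Nx] /= hx.
  by split => //=; rewrite (le_trans hx) // yh.
apply: lime_le; last by apply: nearW => n; exact: yM.
apply: ereal_nondecreasing_is_cvgn => m n mn; apply: le_mu => x [Nx] /= hx.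
by split => //=; rewrite (le_trans hx) // yh.
Qed.

(** Apart from the point sup D when D is bounded above, and its fiber is null, D is
    covered by an increasing sequence of half-lines, each below some point of D. *)
Lemma mu_preimage_le N h D c : all_preimages_measurable N h -> null_fibers N h ->
  0 <= c -> (forall x, D x -> (mu (N `&` h @^-1` low x) <= c%:E)%E) ->
  (mu (N `&` h @^-1` D) <= c%:E)%E.
Proof.
move=> mNh Nh0 c0 Dc.
have [->|/set0P D0] := eqVneq D set0.
  by rewrite preimage_set0 setI0 (_ : mu set0 = 0%E) ?lee_fin //; exact: outer_measure0.
have down x y : D x -> y <= x -> (mu (N `&` h @^-1` low y) <= c%:E)%E.
  move=> /Dc Dx yx; apply: le_trans Dx; apply: le_mu => t [Nt] /= ht.
  by split => //=; rewrite (le_trans ht).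
have [Dub|Dub] := pselect (has_ubound D); last first.
  have Dlarge y : exists2 x, D x & y <= x.
    apply: contrapT => /forall2NP yD; apply: Dub; exists y => x Dx.
    by have [//|/negP] := yD x; rewrite -ltNge => /ltW.
  have nat_le : (mu (N `&` h @^-1` (\bigcup_n low n%:R)) <= c%:E)%E.
    apply: mu_bigcup_le mNh _ _ => [m n|n]; first by rewrite ler_nat.
    by have [x Dx] := Dlarge n%:R; exact: down.
  apply: le_trans nat_le; apply: le_mu => t [Nt _]; split => //.
  by exists (Num.truncn (h t)).+1 => //=; exact/ltW/truncnS_gt.
have Dsup : has_sup D by split.
pose s := sup D.
have lt_s : (mu (N `&` h @^-1` (\bigcup_n low (s - n.+1%:R^-1))) <= c%:E)%E.
  apply: mu_bigcup_le mNh _ _ => [m n mn|n].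
    by rewrite lerD2l lerN2 lef_pV2 ?posrE // ler_nat.
  have [x Dx sx] := @sup_adherent _ D n.+1%:R^-1 ltac:(by rewrite invr_gt0) Dsup.
  exact: down Dx (ltW sx).
apply: (@le_trans _ _ (mu ((N `&` h @^-1` (\bigcup_n low (s - n.+1%:R^-1))) `|`
    (N `&` h @^-1` [set s])))).
  apply: le_mu => t [Nt Dt]; rewrite -setIUr; split => //.
  have [hs|hs] := eqVneq (h t) s; first by right.
  left; have hs' : 0 < s - h t.
    by rewrite subr_gt0 lt_neqAle hs; apply: sup_upper_bound.
  have [n _ nP] := near_infty_natSinv_lt (PosNum hs').
  exists n => //=.
  by have /= := nP n (leqnn n); move: (_^-1) => z; lra.
apply: le_trans (outer_measureU2 len^*%mu _ _) _.
rewrite [X in (_ + X)%E](_ : _ = 0%E); last exact: Nh0.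
by rewrite adde0.
Qed.

(** Mirror image of mu_preimage_le, applied to the opposite of h. *)
Lemma mu_preimage_ge_le N h D c : all_preimages_measurable N h -> null_fibers N h ->
  0 <= c -> (forall x, D x -> (mu (N `&` h @^-1` high x) <= c%:E)%E) ->
  (mu (N `&` h @^-1` D) <= c%:E)%E.
Proof.
move=> mNh Nh0 c0 Dc.
have := @mu_preimage_le N (fun t => - h t) (-%R @^-1` D) c.
rewrite (_ : _ @^-1` (-%R @^-1` D) = h @^-1` D); last first.
  by apply/seteqP; split => t /=; rewrite opprK.
apply => //.
- move=> S; rewrite (_ : _ @^-1` S = h @^-1` (-%R @^-1` S)) //.
- move=> x; rewrite (_ : _ @^-1` [set x] = h @^-1` [set - x]) //.
  by apply/seteqP; split => t /=; [move=> <-; rewrite opprK|move=> ->; rewrite opprK].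
- move=> x Dx; rewrite (_ : _ @^-1` _ = h @^-1` high (- x)); last first.
    by apply/seteqP; split => t /=; lra.
  exact: Dc.
Qed.

(** Distribution function of the image under h of the measure restricted to N. *)
Definition fiber_cdf N h x : R := fine (mu (N `&` h @^-1` low x)).

Lemma mu_sub_fin_num N A : A `<=` N -> (mu N < +oo)%E -> mu A \is a fin_num.
Proof.
by move=> AN Nfin; rewrite ge0_fin_numE ?mu_ge0 // (le_lt_trans (le_mu _ _ AN)).
Qed.

Lemma mu_splitI A B : LM A -> LM B -> mu A = (mu (A `\` B) + mu (A `&` B))%E.
Proof. exact: (@measureDI _ (lebesgueR R) R mu). Qed.

(** Let F be the distribution function. The part of N where F(h) <= b has measure at
    most b, the part where F(h) > a has measure at most mu N - a, and together they
    cover N: their intersection has measure at most b - a. *)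
Lemma mu_fiber_cdf_itv N h a b : all_preimages_measurable N h -> null_fibers N h ->
  (mu N < +oo)%E -> a <= b ->
  (mu (N `&` (fiber_cdf N h \o h) @^-1` [set z | (a < z <= b)%R]) <= (b - a)%:E)%E.
Proof.
move=> mNh Nh0 Nfin ab.
have fin S : mu (N `&` h @^-1` S) \is a fin_num.
  by apply: mu_sub_fin_num Nfin => t [].
pose A := [set x | fiber_cdf N h x <= b]; pose B := [set x | a < fiber_cdf N h x].
have -> : N `&` (fiber_cdf N h \o h) @^-1` [set z | (a < z <= b)%R] =
    N `&` h @^-1` B `&` (N `&` h @^-1` A).
  by apply/seteqP; split => [t [Nt] /= /andP[? ?]|t /= [[Nt ?] [_ ?]]] //; split => //; apply/andP.
have cdfE x : mu (N `&` h @^-1` low x) = (fiber_cdf N h x)%:E by rewrite fineK.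
have mT : LM N by have := mNh setT; rewrite preimage_setT setIT.
have mA := mNh A; have mB := mNh B.
have [->|/set0P[t0 [[Nt0 Bt0] [_ At0]]]] := eqVneq (N `&` h @^-1` B `&` (N `&` h @^-1` A)) set0.
  by rewrite (_ : mu set0 = 0%E) ?lee_fin ?subr_ge0 //; exact: outer_measure0.
have cdf0 x : 0 <= fiber_cdf N h x by rewrite fine_ge0 // mu_ge0.
have b0 : 0 <= b by apply: le_trans (cdf0 (h t0)) At0.
have NA : (mu (N `&` h @^-1` A) <= b%:E)%E.
  by apply: mu_preimage_le => // x Ax; rewrite cdfE lee_fin.
(* The fiber of x being null, it does not matter on which side of x it is counted. *)
have cdf_high x : (fine (mu N))%:E = (mu (N `&` h @^-1` high x) + (fiber_cdf N h x)%:E)%E.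
  rewrite fineK; last exact: mu_sub_fin_num Nfin.
  rewrite -cdfE (mu_splitI _ _ mT (mNh (low x))); congr (_ + _)%E; last first.
    by rewrite setIA setIid.
  apply: le_anti; apply/andP; split.
    apply: le_mu => t [Nt /not_andP[//|/negP]]; rewrite -ltNge => /ltW xt.
    by split.
  have -> : N `&` h @^-1` high x = (N `\` (N `&` h @^-1` low x)) `|` (N `&` h @^-1` [set x]).
    apply/seteqP; split => t /=.
      move=> [Nt xt]; have [->|tx] := eqVneq (h t) x; first by right.
      by left; split => // -[_]; rewrite leNgt lt_neqAle eq_sym tx xt.
    case=> [[Nt]|[Nt ->]]; last by split.
    by move=> /not_andP[//|/negP]; rewrite -ltNge => /ltW.
  apply: le_trans (outer_measureU2 len^*%mu _ _) _.
  rewrite [X in (_ + X)%E](_ : _ = 0%E); last exact: Nh0.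
  by rewrite adde0.
have ma : 0 <= fine (mu N) - a.
  have := cdf_high (h t0); rewrite -(fineK (fin _)) -EFinD => -[->].
  have : 0 <= fine (mu (N `&` h @^-1` high (h t0))) by rewrite fine_ge0 // mu_ge0.
  by move: Bt0; rewrite /B /=; lra.
have NB : (mu (N `&` h @^-1` B) <= (fine (mu N) - a)%:E)%E.
  apply: mu_preimage_ge_le => // x Bx.
  have := cdf_high x; rewrite -(fineK (fin _)) -EFinD => -[->].
  by rewrite lee_fin; move: Bx; rewrite /B /=; lra.
have E1 := mu_splitI _ _ mT mA.
have E2 := mu_splitI _ _ mB mA.
have E3 : (N `&` h @^-1` B) `\` (N `&` h @^-1` A) = N `\` (N `&` h @^-1` A).
  apply/seteqP; split => t /= [].
    by move=> [].
  move=> Nt nA; split => //; split => //; rewrite /B /=.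
  have : ~ fiber_cdf N h (h t) <= b by move=> ?; apply: nA.
  by move/negP; rewrite -ltNge; apply: le_lt_trans.
rewrite E3 in E2; rewrite setIA setIid in E1.
have fd : mu (N `\` (N `&` h @^-1` A)) \is a fin_num by apply: mu_sub_fin_num Nfin => t [].
have fc : mu (N `&` h @^-1` B `&` (N `&` h @^-1` A)) \is a fin_num.
  by apply: mu_sub_fin_num Nfin => t [_ []].
move: NA NB E1 E2; rewrite -(fineK fd) -(fineK fc) -(fineK (fin A)) -(fineK (fin B)).
rewrite !lee_fin => NA NB; rewrite -!EFinD => E1 -[E2].
by rewrite E1 /= in NB; lra.
Qed.

(** Covering S by half-open intervals, this follows from mu_fiber_cdf_itv. It holds for
    arbitrary sets S, mu S being then an outer measure. *)
Lemma mu_fiber_cdf_le N h S : all_preimages_measurable N h -> null_fibers N h ->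
  (mu N < +oo)%E -> (mu (N `&` (fiber_cdf N h \o h) @^-1` S) <= mu S)%E.
Proof.
move=> mNh Nh0 Nfin; apply: le_ereal_inf_tmp => _ [C [mC SC] <-].
apply: (@le_trans _ _ (\sum_(k <oo) mu (N `&` (fiber_cdf N h \o h) @^-1` (C k)))%E).
  apply: le_trans (outer_measure_sigma_subadditive len^*%mu _).
  apply: le_mu => t [Nt /SC[k _ Ck]]; exists k => //.
apply: lee_nneseries => [*|k *]; first exact: mu_ge0.
have /ocitvP [->|[[a b] /= ab ->]] := mC k.
  rewrite preimage_set0 setI0 (_ : mu set0 = 0%E); [exact: wlength_ge0|exact: outer_measure0].
rewrite wlength_itv /= lte_fin ab -EFinB; apply: le_trans (mu_fiber_cdf_itv _ _ _ _ mNh Nh0 Nfin (ltW ab)).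
by apply: le_mu => t /=; rewrite in_itv.
Qed.

(** Lusin's theorem for Lebesgue measurable functions, keeping only the compactness of
    the image of the set on which the function is continuous. *)
Lemma lebesgue_lusin T (G : R -> R) : LM T -> lebesgue_measurable G ->
  mu T <> 0%E -> (mu T < +oo)%E ->
  exists K : set R, [/\ K `<=` T, mu K <> 0%E & compact (G @` K)].
Proof.
move=> mT mG T0 Tfin.
have [Z [G' [mZ Z0 mG' GG']]] := lebesgue_measurable_borel _ mG.
have [B [Z' [mB mZ' Z'0 BT TB]]] := lebesgueR_borel _ mT.
(* A Borel part of T of full measure on which G is Borel. *)
pose T' := B `\` Z.
have mT' : measurable T' by exact: measurableD.
have T'fin : (lam T' < +oo)%E.
  by apply: le_lt_trans Tfin; apply: le_mu => x [/BT].
have T'0 : (0 < lam T')%E.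
  rewrite lt_neqAle measure_ge0 andbT eq_sym; apply/eqP => T'0; apply: T0.
  apply: (null_subset _ (T' `|` (Z `|` Z'))).
    move=> x Tx; have [Bx|Bx] := pselect (B x); last by right; right; apply: TB.
    by have [Zx|Zx] := pselect (Z x); [right; left|left].
  apply/eqP; rewrite eq_le mu_ge0 andbT.
  apply: le_trans (outer_measureU2 len^*%mu _ _) _.
  rewrite [X in (X + _)%E](_ : _ = 0%E) // add0e.
  apply: le_trans (outer_measureU2 len^*%mu _ _) _.
  by rewrite [X in (X + _)%E](_ : _ = 0%E) // add0e [leLHS](_ : _ = 0%E).
have e0 : 0 < fine (lam T') by rewrite fine_gt0 // T'0 T'fin.
have [K [cK KT' TKe cG]] :=
  @measurable_almost_continuous R T' mT' T'fin G' _ e0 (measurable_funTS mG').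
exists K; split.
- by move=> x /KT'[/BT].
- move=> K0; move: TKe.
  rewrite fineK ?ge0_fin_numE // ltNge => /negP; apply.
  have KE : T' = K `|` (T' `\` K).
    by rewrite setDE setUIr setUCr setIT; apply/esym/setUidPr.
  rewrite {1}KE; apply: le_trans (outer_measureU2 len^*%mu _ _) _.
  by rewrite [X in (X + _)%E](_ : _ = 0%E) // add0e.
- have -> : G @` K = G' @` K by apply: eq_imagel => x /KT'[_ /GG'].
  exact: continuous_compact.
Qed.

(** If the preimage under g = F(h) of a rational translate of the Vitali set were not
    null, it would contain a set K that is not null and has a compact image; that image
    is null as a compact part of a Vitali translate, and mu_fiber_cdf_le makes K null. *)
Lemma null_of_all_preimages_measurable N h : all_preimages_measurable N h ->
  null_fibers N h -> (mu N < +oo)%E -> mu N = 0%E.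
Proof.
move=> mNh Nh0 Nfin.
pose g := fiber_cdf N h \o h.
have mN : LM N by have := mNh setT; rewrite preimage_setT setIT.
have mg S : LM (N `&` g @^-1` S) by rewrite /g comp_preimage; exact: mNh.
pose T q := N `&` g @^-1` (vitali_piece q).
apply: (null_subset _ (\bigcup_q T q)).
  by rewrite -setI_bigcupr -preimage_bigcup vitali_piece_cover preimage_setT setIT.
apply: null_bigcup => q; apply: contrapT => T0.
(* Only the trace of g on N is measurable; extended by 0, it is so on the line. *)
pose G t := if t \in N then g t else 0.
have mG : lebesgue_measurable G.
  move=> _ Y mY; rewrite setTI.
  rewrite [X in measurable X](_ : _ = (N `&` g @^-1` Y) `|` (~` N `&` [set _ | Y 0])).
    apply: measurableU => //; apply: measurableI; first exact: measurableC.
    have [Y0|Y0] := pselect (Y 0).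
      by have -> : [set _ : R | Y 0] = setT by [apply/seteqP; split]; exact: measurableT.
    by have -> : [set _ : R | Y 0] = set0 by [apply/seteqP; split]; exact: measurable0.
  apply/seteqP; split => t; rewrite /G /=.
    by case: ifPn => [/set_mem|/negP Nt]; [left|right; split => // /mem_set].
  by case=> [[/mem_set ->]|[Nt ?]] //; rewrite ifN //; apply/negP => /set_mem.
have Tfin : (mu (T q) < +oo)%E by apply: le_lt_trans Nfin; apply: le_mu => t [].
have [K [KT K0 cGK]] := lebesgue_lusin _ _ (mg _) mG T0 Tfin.
have GK0 : mu (G @` K) = 0%E.
  apply: (null_sub_vitali_piece q) => // _ [t /KT[/mem_set Nt gt] <-].
  by rewrite /G Nt.
apply: K0; apply/eqP; rewrite eq_le mu_ge0 andbT -GK0.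
apply: le_trans (mu_fiber_cdf_le _ _ _ mNh Nh0 Nfin).
apply: le_mu => t Kt; have [Nt _] := KT _ Kt; split => //.
by exists t => //; rewrite /G mem_set.
Qed.

(** At an atom x the distribution function jumps, and the jumps at different atoms are
    disjoint intervals: choosing a rational in each of them is injective. *)
Lemma countable_atoms N h : all_preimages_measurable N h -> (mu N < +oo)%E ->
  countable [set x | mu (N `&` h @^-1` [set x]) <> 0%E].
Proof.
move=> mNh Nfin.
have fin S : mu (N `&` h @^-1` S) \is a fin_num.
  by apply: mu_sub_fin_num Nfin => t [].
pose F (S : set R) := fine (mu (N `&` h @^-1` S)).
have jump x : exists q : rat, mu (N `&` h @^-1` [set x]) <> 0%E ->
    F [set z | z < x] < ratr q < F [set z | z <= x].
  have [->|/eqP x0] := eqVneq (mu (N `&` h @^-1` [set x])) 0%E; first by exists 0.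
  have : F [set z | z < x] < F [set z | z <= x].
    rewrite -lte_fin !fineK // (mu_splitI _ _ (mNh [set z | z <= x]) (mNh [set x])).
    rewrite [X in (X + _)%E](_ : _ = mu (N `&` h @^-1` [set z | z < x])); last first.
      congr mu; apply/seteqP; split => t /=.
        move=> [[Nt hx] /not_andP[//|/eqP hx']]; split => //.
        by rewrite lt_neqAle hx'.
      move=> [Nt hx]; split; first by split => //; exact: ltW.
      by move=> [_ hx']; rewrite hx' ltxx in hx.
    rewrite [X in (_ + X)%E](_ : _ = mu (N `&` h @^-1` [set x])); last first.
      by congr mu; apply/seteqP; split => t /=; [move=> [_ //]|move=> [Nt ->]; split => //].
    by rewrite lteDl // lt_neqAle mu_ge0 andbT eq_sym; exact/eqP.
  by move=> /rat_in_itvoo[q]; rewrite in_itv /= => xq; exists q.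
have [q qP] := choice jump.
have mono x y : x < y -> F [set z | z <= x] <= F [set z | z < y].
  move=> xy; rewrite -lee_fin !fineK //; apply: le_mu => t [Nt /= hx].
  by split => //=; exact: le_lt_trans xy.
apply/countable_injP; exists (pickle \o q) => x y /set_mem /= /qP /andP[x1 x2].
move=> /set_mem /= /qP /andP[y1 y2] /(pcan_inj pickleK) qxy.
apply/eqP; case: ltgtP => // [/mono xy|/mono yx].
  by have := lt_le_trans x2 (le_trans xy (ltW y1)); rewrite qxy ltxx.
by have := lt_le_trans y2 (le_trans yx (ltW x1)); rewrite qxy ltxx.
Qed.

(** Replacing every label by one of its preimages in N makes psi real-valued. Once the
    countably many atoms are removed, null_of_all_preimages_measurable applies. *)
Lemma countable_labels (I : choiceType) N (psi : R -> I) : all_preimages_measurable N psi ->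
  exists2 C : set I, countable C & mu (N `\` psi @^-1` C) = 0%E.
Proof.
wlog Nfin : N / (mu N < +oo)%E.
  move=> W mNpsi.
  (* The label sets found on the segments [-n, n] have a countable union. *)
  pose M (n : nat) : set R := `[- n%:R, n%:R]%classic.
  have mM n : all_preimages_measurable (N `&` M n) psi.
    by move=> S; rewrite setIAC; apply: measurableI => //; exact: lebesgueR_itv.
  have finM n : (mu (N `&` M n) < +oo)%E.
    apply: (@le_lt_trans _ _ (lam (M n))); first by apply: le_mu => t [].
    by rewrite /M lebesgue_measure_itv /=; case: ifP; rewrite ?ltry.
  have /choice[C CP] n : exists C : set I, countable C /\ mu (N `&` M n `\` psi @^-1` C) = 0%E.
    by have [C ? ?] := W _ (finM n) (mM n); exists C.
  exists (\bigcup_n C n); first by apply: bigcup_countable => // n _; have [] := CP n.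
  apply: (null_subset _ (\bigcup_n (N `&` M n `\` psi @^-1` (C n)))).
    move=> t [Nt Ct]; exists (Num.truncn `|t|).+1 => //; split.
      split => //; rewrite /M /= in_itv /= -ler_norml; exact/ltW/truncnS_gt.
    by move=> /= Cn; apply: Ct; exists (Num.truncn `|t|).+1.
  by apply: null_bigcup => n; have [] := CP n.
move=> mNpsi.
pose s (i : I) : R := xget 0 (N `&` psi @^-1` [set i]).
have sK t : N t -> psi (s (psi t)) = psi t.
  by move=> Nt; have [] := @xgetI _ 0 (N `&` psi @^-1` [set psi t]) t (conj Nt erefl).
pose h := s \o psi.
have mNh : all_preimages_measurable N h by move=> S; rewrite /h comp_preimage; exact: mNpsi.
pose A := [set x | mu (N `&` h @^-1` [set x]) <> 0%E].
have cA : countable A by exact: countable_atoms.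
exists (psi @` A); first exact: (sub_countable (card_image_le _ _)).
apply: (null_subset _ (N `&` h @^-1` (~` A))).
  move=> t [Nt Ct]; split => //= At; apply: Ct.
  by exists (h t) => //; rewrite /h /= sK.
apply: (null_of_all_preimages_measurable _ h).
- by move=> S; rewrite -setIA -preimage_setI; exact: mNh.
- move=> x; rewrite -setIA -preimage_setI.
  have [Ax|Ax] := pselect (A x).
    rewrite (_ : _ `&` [set x] = set0); first by rewrite preimage_set0 setI0; exact: outer_measure0.
    by apply/seteqP; split => // z [/= Az zx]; apply: Az; rewrite zx.
  apply: null_subset (contrapT Ax); apply: setIS; exact: preimage_subset.
- by apply: le_lt_trans Nfin; apply: le_mu => t [].
Qed.

End image_of_lebesgue.

(** * Essential separability of measurable functions *)

Section essential_separability.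
Context {R : realType} {E : completeMetricType R}.
Local Open Scope classical_set_scope.
Local Open Scope ring_scope.
Local Notation mu := (@completed_lebesgue_measure R).
Local Notation LM A := (measurable (A : set (lebesgueR R))).
Implicit Types (u : R -> E) (x y z : E) (J : set E).

Lemma mdistC x y : mdist x y = mdist y x. Proof. exact: metric_sym. Qed.

Lemma mdist_triangle y x z : mdist x z <= mdist x y + mdist y z.
Proof. exact: metric_triangle. Qed.

Lemma mdist_triangle_sym x y z : mdist x z <= mdist y x + mdist y z.
Proof. by rewrite (mdistC y x); exact: mdist_triangle. Qed.

(** After Stone: well-order E and let phi(z) be the least x with d(z, x) < e. On the set
    En n of points z that stay at distance 2 d_n inside the ball around phi(z), points
    with different phi are at least 2 d_n apart, so the neighbourhoods of radius d_n of
    the pieces of En n on which phi is prescribed are disjoint open sets, all of whose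
    unions are open. Thus phi yields a labelling of a measurable set all of whose
    preimages are measurable, to which countable_labels applies; the sets En n cover E. *)
Lemma ess_countable_net u (e : R) : lebesgue_measurable (u : R -> borel E) -> 0 < e ->
  exists2 C : set E, countable C &
    mu [set t | forall x, C x -> e <= mdist (u t) x] = 0%E.
Proof.
move=> meas_u e0.
have [wo wo_wo] := well_ordering_principle E.
(* Only the existence and uniqueness of least elements is given: reflexivity and
   antisymmetry follow from it on sets with one or two elements. *)
have wo_refl x : wo x x.
  have [y [[/eqP -> yx] _]] := wo_wo (pred1 x) (ex_intro _ x (eqxx x)).
  exact: (yx x (eqxx x)).
have wo_anti x y : wo x y -> wo y x -> x = y.
  move=> xy yx; have [z [_ zmin]] := wo_wo (pred2 x y) (ex_intro _ x (predU1l _ erefl)).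
  transitivity z; [apply/esym|]; apply: zmin; split.
  - exact/predU1l.
  - by move=> t /pred2P[] ->.
  - by rewrite inE eqxx orbT.
  - by move=> t /pred2P[] ->.
have /choice[phi phiP] z : exists x, mdist z x < e /\ forall y, mdist z y < e -> wo x y.
  have [|x [[zx xmin] _]] := wo_wo [pred x | mdist z x < e].
    by exists z; rewrite inE mdistxx.
  by exists x; split.
(* Half of 1/(n+1), so that two points within d n of a third one are less than
   1/(n+1) apart. *)
pose d (n : nat) : R := (n.+1%:R)^-1 / 2.
have d0 n : 0 < d n by rewrite divr_gt0 // invr_gt0.
pose En n := [set z | mdist z (phi z) + d n + d n <= e].
have phi_near n z z' : En n z -> En n z' -> mdist z z' < d n + d n -> phi z = phi z'.
  move=> zE z'E zz'; apply: wo_anti.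
    apply: (phiP z).2; apply: le_lt_trans (mdist_triangle z' z (phi z')) _.
    by move: z'E; rewrite /En /=; lra.
  apply: (phiP z').2; apply: le_lt_trans (mdist_triangle_sym z' z (phi z)) _.
  by move: zE; rewrite /En /=; lra.
pose G n J := \bigcup_(z in En n `&` phi @^-1` J) [set y | mdist z y < d n].
have oG n J : open (G n J).
  apply: bigcup_open => z _; rewrite openE => y /= zy.
  apply/nbhs_ballP; exists (d n - mdist z y); first by rewrite /= subr_gt0.
  move=> y'; rewrite ballEmdist /= => yy'.
  by apply: le_lt_trans (mdist_triangle y _ _) _; rewrite -ltrBrDl.
have mG n J : LM (u @^-1` G n J).
  have := meas_u measurableT (G n J); rewrite setTI; apply.
  by apply: sub_sigma_algebra; exact: oG.
pose zn n t := xget (u t) (En n `&` [set z | mdist z (u t) < d n]).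
pose psi n t := phi (zn n t).
pose N n := u @^-1` G n setT.
have znP n t : N n t -> En n (zn n t) /\ mdist (zn n t) (u t) < d n.
  case=> z [zE _] zu.
  by have := @xgetI _ (u t) (En n `&` [set z | mdist z (u t) < d n]) z (conj zE zu).
have Npsi n J : N n `&` psi n @^-1` J = u @^-1` G n J.
  apply/seteqP; split => t /=.
    by move=> [/znP[zE zu] Jz]; exists (zn n t).
  move=> [z [zE Jz] zu].
  have Nt : N n t by exists z.
  split => //; have [zE' zu'] := znP _ _ Nt.
  rewrite /= /psi -(phi_near _ _ _ zE zE') //.
  by apply: le_lt_trans (mdist_triangle (u t) _ _) _; rewrite (mdistC (u t)) ltrD.
have /choice[C CP] n : exists C : set E, countable C /\ mu (N n `\` psi n @^-1` C) = 0%E.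
  have [|C cC C0] := @countable_labels _ E (N n) (psi n); last by exists C.
  by move=> J; rewrite Npsi.
exists (\bigcup_n C n); first by apply: bigcup_countable => // n _; have [] := CP n.
apply: (null_subset _ (\bigcup_n (N n `\` psi n @^-1` (C n)))); last first.
  by apply: null_bigcup => n; have [] := CP n.
move=> t far.
have [n En_t] : exists n, En n (u t).
  have ed : 0 < e - mdist (u t) (phi (u t)) by rewrite subr_gt0; have [] := phiP (u t).
  have [n _ nP] := near_infty_natSinv_lt (PosNum ed).
  exists n; rewrite /En /=; have /= := nP n (leqnn n); rewrite /d.
  by move: (_^-1) => y; lra.
have Nt : N n t by exists (u t) => //=; rewrite mdistxx.
exists n => //; split => // Ct.
have [zE zu] := znP _ _ Nt.
have := far (psi n t) (ex_intro2 _ _ n Logic.I Ct); rewrite leNgt => /negP; apply.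
apply: le_lt_trans (mdist_triangle (zn n t) _ _) _.
by rewrite mdistC; move: zE (d0 n); rewrite /En /= /psi; lra.
Qed.

Definition ess_dense u (x : nat -> E) :=
  mu [set t | ~ forall e : R, 0 < e -> exists i, mdist (u t) (x i) < e] = 0%E.

Lemma ess_separable u : lebesgue_measurable (u : R -> borel E) ->
  exists x : nat -> E, ess_dense u x.
Proof.
move=> meas_u.
have inv0 k : 0 < k.+1%:R^-1 :> R by rewrite invr_gt0.
have /choice[C CP] k : exists C : set E, countable C /\
    mu [set t | forall x, C x -> k.+1%:R^-1 <= mdist (u t) x] = 0%E.
  by have [C ? ?] := ess_countable_net u _ meas_u (inv0 k); exists C.
have : countable (\bigcup_k C k) by apply: bigcup_countable => // k _; have [] := CP k.
move=> /countable_injP[f finj].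
exists (fun n => xget (u 0) ((\bigcup_k C k) `&` f @^-1` [set n])).
apply: (null_subset _ (\bigcup_k [set t | forall x, C k x -> k.+1%:R^-1 <= mdist (u t) x])).
  move=> t /= nt; apply: contrapT => tC; apply: nt => e e0.
  have [k _ kP] := near_infty_natSinv_lt (PosNum e0).
  have [c Ckc uc] : exists2 c, C k c & mdist (u t) c < k.+1%:R^-1.
    apply: contrapT => /forall2NP H; apply: tC; exists k => //= c Cc.
    by have [//|/negP] := H c; rewrite -leNgt.
  exists (f c); rewrite (_ : xget _ _ = c).
    by apply: lt_trans uc _; exact: kP (leqnn k).
  apply: xget_subset1; first by split => //; exists k.
  move=> a b [Ca fa] [Cb fb]; apply: finj; rewrite ?inE //.
  by rewrite fa fb.
by apply: null_bigcup => k; have [] := CP k.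
Qed.

End essential_separability.

(** * Inequalities between real powers *)

Section powR_inequalities.
Context {R : realType}.
Implicit Types (a b p : R).

Lemma le_powR p a b : 0 <= p -> 0 <= a -> a <= b -> a `^ p <= b `^ p.
Proof.
by move=> p0 a0 ab; apply: ge0_ler_powR; rewrite ?nnegrE // (le_trans a0).
Qed.

Lemma powRD_le p a b : 0 <= p -> 0 <= a -> 0 <= b ->
  (a + b) `^ p <= 2 `^ p * (a `^ p + b `^ p).
Proof.
move=> p0; wlog ab : a b / a <= b.
  move=> W a0 b0; have [ab|/ltW ba] := leP a b; first exact: W.
  by rewrite addrC (addrC (a `^ p)); exact: W.
move=> a0 b0; apply: (@le_trans _ _ ((2 * b) `^ p)).
  by apply: le_powR => //; lra.
rewrite powRM // ler_wpM2l ?powR_ge0 // lerDr powR_ge0 //.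
Qed.

(** Write x^p as x times x^(p-1), and use that x |-> x^(p-1) is nondecreasing. *)
Lemma powR_superadditive p a b : 1 <= p -> 0 <= a -> 0 <= b ->
  a `^ p + b `^ p <= (a + b) `^ p.
Proof.
move=> p1 a0 b0.
have E x : 0 <= x -> x `^ p = x * x `^ (p - 1).
  rewrite le_eqVlt => /predU1P[<-|x0]; first by rewrite mul0r powR0 //; lra.
  rewrite -{2}(powRr1 (ltW x0)) -powRD; first by congr (_ `^ _); lra.
  by rewrite (gt_eqF x0) implybT.
rewrite (E _ a0) (E _ b0) (E _ (addr_ge0 a0 b0)) mulrDl.
by apply: lerD; apply: ler_wpM2l => //; apply: le_powR; lra.
Qed.

(** Reduces the continuity of translations in L^p to the one in L^1. *)
Lemma powR_dist_le p a b : 1 <= p -> 0 <= a -> 0 <= b ->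
  `|a - b| `^ p <= `|a `^ p - b `^ p|.
Proof.
move=> p1; wlog ab : a b / b <= a.
  move=> W a0 b0; have [ba|/ltW ab] := leP b a; first exact: W.
  by rewrite distrC (distrC (a `^ p)); exact: W.
move=> a0 b0; rewrite ger0_norm ?subr_ge0 //.
have := @powR_superadditive p (a - b) b p1; rewrite subrK => H.
by apply: le_trans (ler_norm _); rewrite lerBrDr; apply: H => //; lra.
Qed.

End powR_inequalities.

(** * Distances between measurable functions, and finite nets *)

Section metric_valued_functions.
Context {R : realType} {E : completeMetricType R}.
Local Open Scope classical_set_scope.
Local Open Scope ring_scope.
Local Notation mu := (@completed_lebesgue_measure R).
Local Notation LM A := (measurable (A : set (lebesgueR R))).
Implicit Types (u v w : R -> E) (x y z : E) (a b c p : R).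

Lemma measurable_mdist_cst w x : lebesgue_measurable (w : R -> borel E) ->
  lebesgue_measurable (fun t => mdist (w t) x).
Proof.
move=> mw; apply: (measurability _ (RGenOInfty.measurableE R)) => _ [_ [r ->] <-].
have -> : (fun t => mdist (w t) x) @^-1` `]r, +oo[ = w @^-1` [set y | r < mdist y x].
  by apply/seteqP; split => t /=; rewrite in_itv /= andbT.
apply: mw => //; apply: sub_sigma_algebra; rewrite /= openE => y /= ry.
apply/nbhs_ballP; exists (mdist y x - r); first by rewrite /= subr_gt0.
move=> y'; rewrite ballEmdist /= => yy'.
by have := mdist_triangle y' y x; lra.
Qed.

(** When E is not separable, the distance need not be measurable for the product of the
    Borel sigma-algebra of E with itself. With x dense in the essential range of u, at
    almost every t the distance is below r exactly when d(u(t), x_i) + d(v(t), x_i) < r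
    for some i. *)
Lemma measurable_mdist u v : lebesgue_measurable (u : R -> borel E) ->
  lebesgue_measurable (v : R -> borel E) ->
  lebesgue_measurable (fun t => mdist (u t) (v t)).
Proof.
move=> meas_u mv.
have [x xP] := ess_separable u meas_u.
apply: (measurability _ (RGenInftyO.measurableE R)) => _ [_ [r ->] <-].
rewrite setTI; move: xP; rewrite /ess_dense; set Z := [set t | ~ _] => xP.
have mZ : LM Z by exact: null_lebesgueR.
pose W i := [set t | mdist (u t) (x i) + mdist (v t) (x i) < r].
have mW i : LM (W i).
  have := @measurable_funD _ (lebesgueR R) R setT _ _ (measurable_mdist_cst u (x i) meas_u)
    (measurable_mdist_cst v (x i) mv) measurableT `]-oo, r[%classic (measurable_itv _).
  by rewrite setTI; congr measurable; apply/seteqP; split => t /=; rewrite in_itv.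
set P := (X in measurable X).
have -> : P = (\bigcup_i W i `\` Z) `|` (P `&` Z).
  apply/seteqP; split => t.
    move=> Pt; have [Zt|/contrapT Zt] := pselect (Z t); first by right.
    left; split; last by move=> nZ; exact: nZ.
    move: Pt; rewrite /P /= in_itv /= => uvr.
    have [i xi] := Zt ((r - mdist (u t) (v t)) / 2) ltac:(lra).
    exists i => //; rewrite /W /=.
    by have := mdist_triangle (u t) (v t) (x i); rewrite (mdistC (v t) (u t)); lra.
  case=> [[[i _ Wt] _]|[]//]; rewrite /P /= in_itv /=.
  apply: le_lt_trans Wt; rewrite (mdistC (v t)); exact: mdist_triangle.
apply: measurableU; first by apply: measurableD => //; exact: bigcupT_measurable.
by apply: null_lebesgueR; apply: null_subset xP => t [].
Qed.

Fixpoint net_dist (x : nat -> E) (n : nat) (y : E) : R :=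
  if n is m.+1 then Num.min (net_dist x m y) (mdist y (x n)) else mdist y (x 0%N).

Lemma net_distP (s : nat -> E) n y : exists2 i, (i <= n)%N & net_dist s n y = mdist y (s i).
Proof.
elim: n => [|n [i i_n E_]] /=; first by exists 0%N.
case: leP => _; [exists i => //; exact: leqW|by exists n.+1].
Qed.

Lemma net_dist_le (s : nat -> E) n i y : (i <= n)%N -> net_dist s n y <= mdist y (s i).
Proof.
elim: n => [|n IH] /=; first by rewrite leqn0 => /eqP->.
rewrite leq_eqVlt => /predU1P[->|/IH h]; first by rewrite ge_min lexx orbT.
by rewrite ge_min h.
Qed.

Lemma net_dist_ge0 (s : nat -> E) n y : 0 <= net_dist s n y.
Proof. by have [i _ ->] := net_distP s n y; exact: mdist_ge0. Qed.

Lemma net_dist_lip (s : nat -> E) n y z : net_dist s n y <= mdist y z + net_dist s n z.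
Proof.
have [i i_n ->] := net_distP s n z.
by apply: le_trans (net_dist_le s n i y i_n) _; exact: mdist_triangle.
Qed.

Lemma measurable_net_dist w (s : nat -> E) n : lebesgue_measurable (w : R -> borel E) ->
  lebesgue_measurable (fun t => net_dist s n (w t)).
Proof.
move=> mw; elim: n => [|n IH] /=; first exact: measurable_mdist_cst.
by apply: lebesgue_measurable_min => //; exact: measurable_mdist_cst.
Qed.

(** Dominated convergence: the distance to x_0, ..., x_n decreases to 0 almost everywhere
    and is bounded by the distance to x_0. *)
Lemma segint_net_dist w (s : nat -> E) p a b c : lebesgue_measurable (w : R -> borel E) ->
  0 < p -> ess_dense w s ->
  (segint a b (fun t => (mdist (w t) (s 0%N) `^ p)%R) < +oo)%E -> 0 < c ->
  exists n, (segint a b (fun t => (net_dist s n (w t) `^ p)%R) <= c%:E)%E.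
Proof.
move=> mw p0 sw fin c0.
have mD : LM `[a, b]%classic by exact: lebesgueR_itv.
have mf n : @measurable_fun _ _ (lebesgueR R) _ `[a, b]%classic
    (fun t => (net_dist s n (w t) `^ p)%:E).
  apply/measurable_EFinP; apply: measurable_funTS; apply: lebesgue_measurable_pow.
  exact: measurable_net_dist.
have := @dominated_convergence _ (lebesgueR R) R mu `[a, b]%classic mD
  (fun n t => (net_dist s n (w t) `^ p)%:E) (fun=> 0%E)
  (fun t => (mdist (w t) (s 0%N) `^ p)%:E) mf.
case.
- exact: measurable_cst.
- exists [set t | ~ forall e : R, 0 < e -> exists i, mdist (w t) (s i) < e].
  split => //; first exact: null_lebesgueR.
  move=> t /= ncv; apply: contra_not ncv => wt _.
  apply: cvg_EFin; first exact: nearW.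
  apply/cvgrPdist_le => e e0.
  have [i wi] := wt (e `^ p^-1) (powR_gt0 _ e0).
  exists i => // n /= i_n; rewrite sub0r normrN ger0_norm ?powR_ge0 //.
  apply: (@le_trans _ _ ((e `^ p^-1) `^ p)).
    apply: le_powR; [exact: ltW|exact: net_dist_ge0|].
    exact: le_trans (net_dist_le s n i _ i_n) (ltW wi).
  by rewrite -powRrM mulVf ?gt_eqF // powRr1 // ltW.
- apply/integrableP; split.
    apply/measurable_EFinP; apply: measurable_funTS; apply: lebesgue_measurable_pow.
    exact: measurable_mdist_cst.
  apply: le_lt_trans fin; rewrite le_eqVlt; apply/orP; left; apply/eqP.
  by apply: eq_integral => t _; rewrite gee0_abs // lee_fin powR_ge0.
- apply: aeW => t n _; rewrite gee0_abs ?lee_fin ?powR_ge0 //.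
  by apply: le_powR; [exact: ltW|exact: net_dist_ge0|exact: net_dist_le].
move=> _ _; rewrite integral0 => /cvge0_lt/(_ c0)[n]; exists n; exact: ltW.
Qed.

End metric_valued_functions.

(** * Stepanov almost periods *)

Section almost_periods.
Context {R : realType} {E : completeMetricType R}.
Local Open Scope classical_set_scope.
Local Open Scope ring_scope.
Local Notation mu := (@completed_lebesgue_measure R).
Local Notation LM A := (measurable (A : set (lebesgueR R))).
Local Notation bm w := (lebesgue_measurable (w : R -> borel E)).
Implicit Types (u v w : R -> E) (x y z : E) (a b c p s t tau : R).

Definition dist_pow p u v : R -> R := fun t => mdist (u t) (v t) `^ p.

Definition translate w tau : R -> E := fun t => w (t + tau).

(** The unit segments carry the p-th power of the Stepanov distance between w and its
    translate, which avoids taking p-th roots. *)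
Definition almost_period p w c : set R :=
  [set tau | forall a, (segint a (a + 1) (dist_pow p (translate w tau) w) <= c%:E)%E].

Lemma dist_pow_ge0 p u v t : 0 <= dist_pow p u v t. Proof. exact: powR_ge0. Qed.

Lemma measurable_dist_pow p u v : bm u -> bm v -> lebesgue_measurable (dist_pow p u v).
Proof. by move=> meas_u mv; apply: lebesgue_measurable_pow; exact: measurable_mdist. Qed.

Lemma measurable_translate w tau : bm w -> bm (translate w tau).
Proof. exact: lebesgue_measurable_shift. Qed.

Lemma dist_pow_triangle p u v w t : 0 <= p ->
  dist_pow p u w t <= 2 `^ p * (dist_pow p u v t + dist_pow p v w t).
Proof.
move=> p0; apply: le_trans (powRD_le p _ _ p0 (mdist_ge0 _ _) (mdist_ge0 _ _)).
by apply: le_powR => //; [exact: mdist_ge0|exact: mdist_triangle].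
Qed.

Lemma segint_dist_pow_triangle p u v w a b (c1 c2 : R) : 0 <= p -> bm u -> bm v -> bm w ->
  (segint a b (dist_pow p u v) <= c1%:E)%E -> (segint a b (dist_pow p v w) <= c2%:E)%E ->
  (segint a b (dist_pow p u w) <= (2 `^ p * (c1 + c2))%:E)%E.
Proof.
move=> p0 meas_u mv mw uv vw.
have m1 := measurable_dist_pow p _ _ meas_u mv.
have m2 := measurable_dist_pow p _ _ mv mw.
have m3 : lebesgue_measurable (fun t => dist_pow p u v t + dist_pow p v w t).
  exact: lebesgue_measurableD.
have K0 : 0 <= 2 `^ p by exact: powR_ge0.
apply: (@le_trans _ _ (segint a b (fun t => 2 `^ p * (dist_pow p u v t + dist_pow p v w t)))).
  apply: le_segint.
  - exact: measurable_dist_pow.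
  - by apply: lebesgue_measurableM => //; exact: lebesgue_measurable_cst.
  - by move=> t; exact: dist_pow_ge0.
  - by move=> t _; exact: dist_pow_triangle.
rewrite segintZ //; last by move=> t; rewrite addr_ge0 ?dist_pow_ge0.
rewrite (segintD a b _ _ m1 m2) //; try by move=> t; exact: dist_pow_ge0.
by rewrite EFinM lee_wpmul2l ?lee_fin // EFinD leeD.
Qed.

Lemma locally_integrable_dist p w y a b : 0 <= p -> locally_integrable_pow p w ->
  (segint a b (dist_pow p w (fun=> y)) < +oo)%E.
Proof.
move=> p0 [mw [x0 fin]].
have mc z : bm (fun=> z) by exact: measurable_cst.
have ab : a < Num.max b (a + 1) by rewrite lt_max; apply/orP; right; lra.
apply: (@le_lt_trans _ _ (segint a (Num.max b (a + 1)) (dist_pow p w (fun=> y)))).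
  apply: segintS => //; first exact: measurable_dist_pow.
    by move=> t; exact: dist_pow_ge0.
  by rewrite le_max lexx.
move: (Num.max b (a + 1)) ab => {}b ab.
have w0 : segint a b (dist_pow p w (fun=> x0)) = (fine (segint a b (dist_pow p w (fun=> x0))))%:E.
  rewrite fineK // ge0_fin_numE; first exact: fin.
  by apply: segint_ge0 => t; exact: dist_pow_ge0.
apply: le_lt_trans (ltry _).
apply: (segint_dist_pow_triangle p _ (fun=> x0)) => //; first by rewrite w0.
by rewrite /dist_pow segint_cst // ltW.
Qed.

Lemma almost_periodN p w c tau : bm w -> almost_period p w c tau -> almost_period p w c (- tau).
Proof.
move=> mw wt a; have := wt (a - tau).
rewrite (_ : a - tau + 1 = a + 1 - tau); last by ring.
rewrite -segint_shift; first last.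
- by move=> t; exact: dist_pow_ge0.
- by apply: measurable_dist_pow => //; exact: measurable_translate.
apply: eq_segint_le => t.
by rewrite /dist_pow /translate subrK mdistC.
Qed.

(** Quasi-triangle inequality through the translate by t; the Stepanov bound is invariant
    under translation because it ranges over all unit segments. *)
Lemma almost_periodD p w (c1 c2 : R) s t : 0 <= p -> bm w ->
  almost_period p w c1 s -> almost_period p w c2 t ->
  almost_period p w (2 `^ p * (c1 + c2)) (s + t).
Proof.
move=> p0 mw ws wt a.
apply: (segint_dist_pow_triangle p _ (translate w t)) => //.
- exact: measurable_translate.
- exact: measurable_translate.
have := ws (a + t); rewrite addrAC -segint_shift; first last.
- by move=> r; exact: dist_pow_ge0.
- by apply: measurable_dist_pow => //; exact: measurable_translate.
apply: eq_segint_le => r.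
by rewrite /dist_pow /translate -addrA (addrC t).
Qed.

Lemma le_almost_period p w (c1 c2 : R) : c1 <= c2 ->
  almost_period p w c1 `<=` almost_period p w c2.
Proof. by move=> c12 t wt a; apply: le_trans (wt a) _; rewrite lee_fin. Qed.

Lemma stepanov_distP p u v (e : R) : 0 < p -> 0 <= e ->
  (stepanov_dist p u v <= e%:E)%E <->
  forall a, (segint a (a + 1) (dist_pow p u v) <= (e `^ p)%:E)%E.
Proof.
move=> p0 e0.
have pV0 : 0 <= p^-1 by rewrite invr_ge0 ltW.
have I0 a : (0 <= segint a (a + 1) (dist_pow p u v))%E.
  by apply: segint_ge0 => t; exact: dist_pow_ge0.
have e0' : (0 <= e%:E)%E by rewrite lee_fin.
have pw (x y : \bar R) r : (0 <= r)%R -> (0 <= x)%E -> (0 <= y)%E -> (x <= y)%E -> (x `^ r <= y `^ r)%E.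
  by move=> r0 x0 y0 xy; apply: gt0_ler_poweR; rewrite ?in_itv /= ?x0 ?y0 ?leey.
split => [uv a|uv].
  have : (poweR (segint a (a + 1) (dist_pow p u v)) p^-1 <= e%:E)%E.
    by apply: le_trans uv; apply: ereal_sup_ubound; exists a.
  move=> /(pw _ _ p (ltW p0) (poweR_ge0 _ _) e0').
  by rewrite -poweRrM mulVf ?gt_eqF // poweRe1 // poweR_EFin.
apply: ge_ereal_sup => _ [a _ <-].
apply: le_trans (pw _ _ _ pV0 (I0 a) _ (uv a)) _; first by rewrite lee_fin powR_ge0.
by rewrite poweR_EFin -powRrM mulfV ?gt_eqF // powRr1.
Qed.

Lemma stepanov_ap_dense p w c : 0 < p -> stepanov_ap p w -> 0 < c ->
  relatively_dense (almost_period p w c).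
Proof.
move=> p0 [_ wap] c0; have [l l0 lP] := wap _ (powR_gt0 p^-1 c0).
exists l => // a; have [t [wt tI]] := lP a; exists t; split => // x.
have /(stepanov_distP p _ _ _ p0 (powR_ge0 _ _))/(_ x) := wt.
by rewrite -powRrM mulVf ?gt_eqF // powRr1 // ltW.
Qed.

Lemma stepanov_ap_of_dense p w : 0 < p -> locally_integrable_pow p w ->
  (forall c, 0 < c -> relatively_dense (almost_period p w c)) -> stepanov_ap p w.
Proof.
move=> p0 wi wap; split => // e e0.
have [l l0 lP] := wap _ (powR_gt0 p e0).
exists l => // a; have [t [wt tI]] := lP a; exists t; split => //.
by apply/(stepanov_distP p _ _ _ p0 (ltW e0)).
Qed.

End almost_periods.

(** * Continuity of translations and uniform finite nets *)

Section translation_continuity.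
Context {R : realType} {E : completeMetricType R}.
Local Open Scope classical_set_scope.
Local Open Scope ring_scope.
Local Notation mu := (@completed_lebesgue_measure R).
Local Notation LM A := (measurable (A : set (lebesgueR R))).
Local Notation bm w := (lebesgue_measurable (w : R -> borel E)).
Implicit Types (u v w : R -> E) (x y z : E) (a b c p s t tau : R).

Lemma lebesgue_measurable_sum (k : nat -> R -> R) n :
  (forall i, lebesgue_measurable (k i)) ->
  lebesgue_measurable (fun t => \sum_(i < n) k i t).
Proof.
move=> mk; elim: n => [|n IH].
  have -> : (fun t => \sum_(i < 0) k i t) = fun=> 0.
    by apply/funext => t; rewrite big_ord0.
  exact: lebesgue_measurable_cst.
have -> : (fun t => \sum_(i < n.+1) k i t) = fun t => \sum_(i < n) k i t + k n t.
  by apply/funext => t; rewrite big_ord_recr.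
exact: lebesgue_measurableD.
Qed.

Lemma translation_continuous_sum (k : nat -> R -> R) n a b c :
  (forall i, lebesgue_measurable (k i)) -> (forall i t, 0 <= k i t) ->
  (forall i, (segint (a - 1) (b + 1) (k i) < +oo)%E) -> a <= b -> 0 < c ->
  exists2 d, 0 < d & forall s, `|s| <= d ->
    (segint a b (fun t => \sum_(i < n) `|k i (t + s)%R - k i t|)%R <= c%:E)%E.
Proof.
move=> mk k0 kfin ab; elim: n c => [|n IH] c c0.
  exists 1 => // s _.
  rewrite (_ : (fun t => _) = fun=> 0); last by apply/funext => t; rewrite big_ord0.
  by rewrite segint_cst // mul0r lee_fin ltW.
have [d1 d10 d1P] := IH _ (divr_gt0 c0 (@ltr0Sn R 1)).
have [d2 d20 d2P] := translation_continuous_L1 (k n) a b _ (mk n) (k0 n) ab (kfin n)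
  (divr_gt0 c0 (@ltr0Sn R 1)).
exists (Num.min d1 d2); first by rewrite lt_min d10.
move=> s; rewrite le_min => /andP[/d1P s1 /d2P s2].
rewrite (_ : (fun t => _) = fun t =>
  \sum_(i < n) `|k i (t + s) - k i t| + `|k n (t + s) - k n t|); last first.
  by apply/funext => t; rewrite big_ord_recr.
have mdist_k i : lebesgue_measurable (fun t => `|k i (t + s) - k i t|).
  exact: lebesgue_measurable_dist (lebesgue_measurable_shift _ _ _ _ (mk i)) (mk i).
rewrite segintD //.
- by apply: le_trans (leeD s1 s2) _; rewrite -EFinD lee_fin; lra.
- exact: (lebesgue_measurable_sum (fun i t => `|k i (t + s) - k i t|)).
- by move=> t; apply: sumr_ge0.
Qed.

(** If x_i is the point nearest to w(t) among x_0, ..., x_n, then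
    d(w(t+s), w(t)) <= d(w(t+s), x_i) + d(w(t), x_i)
                    <= 2 d(w(t), x_i) + |d(w(t+s), x_i) - d(w(t), x_i)|,
    where the first term is small in L^p for large n, and the second one is a real
    difference to which powR_dist_le and L^1 continuity apply. *)
Lemma translation_continuous_segment p w a b c : 1 <= p -> locally_integrable_pow p w ->
  a <= b -> 0 < c ->
  exists2 d, 0 < d & forall s, `|s| <= d ->
    (segint a b (dist_pow p (translate w s) w) <= c%:E)%E.
Proof.
move=> p1 wi ab c0; have mw := wi.1.
have p0 : 0 < p by lra.
have [x xw] := ess_separable w mw.
pose K := 2 `^ p; have K0 : 0 < K by rewrite powR_gt0.
have fin y := locally_integrable_dist p w y _ _ (ltW p0) wi.
have c1 : 0 < c / (2 * K * K) by rewrite divr_gt0 // !mulr_gt0.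
have c2 : 0 < c / (2 * K) by rewrite divr_gt0 // mulr_gt0.
have [n netn] := segint_net_dist w x p a b _ mw p0 xw (fin _ _ _) c1.
pose k i := dist_pow p w (fun=> x i).
have mk i : lebesgue_measurable (k i).
  by apply: measurable_dist_pow => //; exact: measurable_cst.
have k0 i t : 0 <= k i t by exact: dist_pow_ge0.
have [d d0 dP] := translation_continuous_sum k n.+1 a b _ mk k0 (fun i => fin _ _ _) ab c2.
exists d => // s /dP {}dP.
pose m t := net_dist x n (w t) `^ p.
have mm : lebesgue_measurable m by apply: lebesgue_measurable_pow; exact: measurable_net_dist.
have m0 t : 0 <= m t by exact: powR_ge0.
pose S t := \sum_(i < n.+1) `|k i (t + s) - k i t|.
have mS : lebesgue_measurable S.
  apply: (lebesgue_measurable_sum (fun i t => `|k i (t + s) - k i t|)) => i.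
  exact: lebesgue_measurable_dist (lebesgue_measurable_shift _ _ _ _ (mk i)) (mk i).
have S0 t : 0 <= S t by exact: sumr_ge0.
have mKm : lebesgue_measurable (fun t => K * m t).
  exact: lebesgue_measurableM (lebesgue_measurable_cst _) _.
have Km0 t : 0 <= K * m t by apply: mulr_ge0 => //; exact: ltW.
have mKmS : lebesgue_measurable (fun t => K * m t + S t) by exact: lebesgue_measurableD.
apply: (@le_trans _ _ (segint a b (fun t => K * (K * m t + S t)))).
  apply: le_segint.
  - by apply: measurable_dist_pow => //; exact: measurable_translate.
  - exact: lebesgue_measurableM (lebesgue_measurable_cst _) _.
  - by move=> t; exact: dist_pow_ge0.
  move=> t _; rewrite /dist_pow /translate.
  have [i i_n mi] := net_distP x n (w t).
  pose A := `|mdist (w (t + s)) (x i) - mdist (w t) (x i)|.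
  apply: (@le_trans _ _ ((2 * mdist (w t) (x i) + A) `^ p)).
    apply: le_powR; [exact: ltW|exact: mdist_ge0|].
    apply: le_trans (mdist_triangle (x i) _ _) _.
    rewrite (mdistC (x i)); have := ler_norm (mdist (w (t + s)) (x i) - mdist (w t) (x i)).
    by rewrite -/A; lra.
  have A0 : 0 <= A by exact: normr_ge0.
  have D0 := mdist_ge0 (w t) (x i).
  apply: le_trans (powRD_le p _ _ (ltW p0) _ A0) _; first by rewrite mulr_ge0.
  rewrite ler_wpM2l ?(ltW K0) // powRM // /m mi lerD //.
  apply: le_trans (powR_dist_le _ _ _ p1 (mdist_ge0 _ _) (mdist_ge0 _ _)) _.
  rewrite /S (bigD1 (inord i)) //= inordK // lerDl; exact: sumr_ge0.
rewrite segintZ //; [|exact: ltW|by move=> t; exact: addr_ge0].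
rewrite segintD // segintZ //; last exact: ltW.
have -> : c = K * (K * (c / (2 * K * K)) + c / (2 * K)) by field; lra.
rewrite EFinM lee_wpmul2l ?lee_fin ?(ltW K0) // EFinD leeD //.
by rewrite EFinM lee_wpmul2l ?lee_fin ?(ltW K0).
Qed.

Lemma relatively_dense_into (T : set R) : relatively_dense T ->
  exists2 l, 0 < l & forall a, exists2 tau, T tau & 0 <= a + tau /\ a + tau <= l.
Proof.
move=> [l l0 lT]; exists l => // a.
have [t [Tt]] := lT (- a); rewrite /= in_itv /= => /andP[? ?].
by exists t => //; split; lra.
Qed.

(** An almost period t brings any unit segment into one fixed long segment, where
    translations are continuous; w(.+s) is compared with w through w(.+s+t) and w(.+t). *)
Lemma almost_period_near0 p w c : 1 <= p -> stepanov_ap p w -> 0 < c ->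
  exists2 d, 0 < d & forall s, `|s| <= d -> almost_period p w c s.
Proof.
move=> p1 wap c0; have [wi _] := wap; have mw := wi.1.
have p0 : 0 < p by lra.
pose K := 2 `^ p; have K0 : 0 < K by rewrite powR_gt0.
(* Two applications of the quasi-triangle inequality turn three bounds c1 into
   2 K^2 c1 + K c1, which is at most c. *)
pose c1 := c / (4 * K * K + K).
have D0 : 0 < 4 * K * K + K by rewrite addr_gt0 // !mulr_gt0.
have c10 : 0 < c1 by rewrite divr_gt0.
have [l l0 lP] := relatively_dense_into _ (stepanov_ap_dense _ _ _ p0 wap c10).
have l10 : 0 <= l + 1 by lra.
have [d d0 dP] := translation_continuous_segment p w 0 (l + 1) c1 p1 wi l10 c10.
exists d => // s /dP {}dP a.
have [t wt [ta tl]] := lP a.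
have E1 : (segint a (a + 1) (dist_pow p (translate w s) (translate w (s + t))) <= c1%:E)%E.
  have := wt (a + s); rewrite addrAC -segint_shift; first last.
  - by move=> r; exact: dist_pow_ge0.
  - by apply: measurable_dist_pow => //; exact: measurable_translate.
  apply: eq_segint_le => r.
  by rewrite /dist_pow /translate -addrA mdistC.
have E2 : (segint a (a + 1) (dist_pow p (translate w (s + t)) (translate w t)) <= c1%:E)%E.
  have : (segint (a + t) (a + 1 + t) (dist_pow p (translate w s) w) <= c1%:E)%E.
    have m1 := measurable_dist_pow p _ _ (measurable_translate w s mw) mw.
    by apply: le_trans dP; apply: (segintS _ _ _ _ _ m1 (dist_pow_ge0 p _ _)); lra.
  rewrite -segint_shift; first last.
  - by move=> r; exact: dist_pow_ge0.
  - by apply: measurable_dist_pow => //; exact: measurable_translate.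
  apply: eq_segint_le => r.
  by rewrite /dist_pow /translate -addrA (addrC t).
have mt r : bm (translate w r) by exact: measurable_translate.
have E3 := segint_dist_pow_triangle p _ _ _ _ _ _ _ (ltW p0) (mt s) (mt (s + t)) (mt t) E1 E2.
have := segint_dist_pow_triangle p _ _ _ _ _ _ _ (ltW p0) (mt s) (mt t) mw E3 (wt a).
move/le_trans; apply; rewrite lee_fin -/K.
have -> : c = (4 * K * K + K) * c1 by rewrite mulrC divfK // gt_eqF.
have H : 0 <= K * K * c1 by apply: mulr_ge0; [apply: mulr_ge0; exact: ltW|exact: ltW].
rewrite -subr_ge0 (_ : _ - _ = 2 * (K * K * c1)); first by rewrite mulr_ge0.
ring.
Qed.

(** The distance to a finite set is 1-Lipschitz, so that an almost period transports the
    bound of segint_net_dist from one long segment to all unit segments. *)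
Lemma uniform_net p w (x : nat -> E) c : 1 <= p -> stepanov_ap p w -> ess_dense w x -> 0 < c ->
  exists n, forall a, (segint a (a + 1) (fun t => (net_dist x n (w t) `^ p)%R) <= c%:E)%E.
Proof.
move=> p1 wap xw c0; have [wi _] := wap; have mw := wi.1.
have p0 : 0 < p by lra.
pose K := 2 `^ p; have K0 : 0 < K by rewrite powR_gt0.
have c10 : 0 < c / (2 * K) by rewrite divr_gt0 // mulr_gt0.
have [l l0 lP] := relatively_dense_into _ (stepanov_ap_dense _ _ _ p0 wap c10).
have fin := locally_integrable_dist p w (x 0%N) 0 (l + 1) (ltW p0) wi.
have [n netn] := segint_net_dist w x p _ _ _ mw p0 xw fin c10.
exists n => a; have [t wt [ta tl]] := lP a.
pose m t := net_dist x n (w t) `^ p.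
have mm : lebesgue_measurable m by apply: lebesgue_measurable_pow; exact: measurable_net_dist.
have m0 r : 0 <= m r by exact: powR_ge0.
pose D := dist_pow p (translate w t) w.
have mD : lebesgue_measurable D.
  by apply: measurable_dist_pow => //; exact: measurable_translate.
have D0 r : 0 <= D r by exact: dist_pow_ge0.
have mm' : lebesgue_measurable (fun r => m (r + t)) by exact: lebesgue_measurable_shift.
have mDm : lebesgue_measurable (fun r => D r + m (r + t)) by exact: lebesgue_measurableD.
apply: (@le_trans _ _ (segint a (a + 1) (fun r => K * (D r + m (r + t))))).
  apply: le_segint; [exact: mm|exact: lebesgue_measurableM (lebesgue_measurable_cst _) mDm|exact: m0|].
  move=> r _; apply: le_trans (powRD_le p _ _ (ltW p0) (mdist_ge0 _ _) (net_dist_ge0 _ _ _)).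
  apply: le_powR; [exact: ltW|exact: net_dist_ge0|].
  by rewrite /translate mdistC; exact: net_dist_lip.
rewrite segintZ //; [|exact: ltW|by move=> r; exact: addr_ge0].
rewrite segintD //.
have -> : c = K * (c / (2 * K) + c / (2 * K)) by field; lra.
rewrite EFinM; apply: lee_wpmul2l; first by rewrite lee_fin ltW.
rewrite EFinD; apply: leeD; first exact: wt.
rewrite segint_shift; [|exact: mm|exact: m0]; apply: le_trans netn.
by apply: (segintS _ _ _ _ _ mm m0); lra.
Qed.

End translation_continuity.

(** * Common almost periods *)

Section bohr_families.
Context {R : realType}.
Local Open Scope classical_set_scope.
Local Open Scope ring_scope.
Implicit Types (P Q : R -> set R) (a c d s t : R).

(** Axiomatization of the sets of almost periods of tolerance c of a function whose small
    translations are almost periods. The third condition stands for the triangle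
    inequality, up to a change of tolerance. *)
Definition bohr_family P := [/\
  forall c1 c2, c1 <= c2 -> P c1 `<=` P c2,
  forall c t, P c t -> P c (- t),
  forall c, 0 < c -> exists2 c', 0 < c' & forall s t, P c' s -> P c' t -> P c (s + t),
  forall c, 0 < c -> exists2 d, 0 < d & forall s, `|s| <= d -> P c s &
  forall c, 0 < c -> relatively_dense (P c)].

Lemma same_truncn_dist (x y : R) : 0 <= x -> 0 <= y ->
  Num.truncn x = Num.truncn y -> `|x - y| <= 1.
Proof.
move=> x0 y0 xy; have := truncn_itv x0; have := truncn_itv y0.
rewrite xy -natr1; move: (_%:R) => k /andP[? ?] /andP[? ?].
by rewrite ler_norml; apply/andP; split; lra.
Qed.

(** Bohr's argument. Every segment of length l contains t1 in P and t2 in Q, with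
    t1 - t2 in [-l, l]. Cut [-l, l] into finitely many pieces of length d and fix, for
    each piece that occurs, a pair (s1, s2) with s1 - s2 in it. For a pair (t1, t2) of
    the same piece, t1 - s1 is an almost period for P, and differs by at most d from
    t2 - s2, which is one for Q; the finitely many s1 are bounded. *)
Lemma bohr_familyI_dense P Q c : bohr_family P -> bohr_family Q -> 0 < c ->
  relatively_dense (P c `&` Q c).
Proof.
move=> [_ PN PD _ Pdense] [_ QN QD Qnear Qdense] c0.
have [p1 p10 PP] := PD c c0.
have [q1 q10 QQ] := QD c c0.
(* In Q two additions occur: t2 - s2, then the correction by at most d. *)
have [q2 q20 QQ1] := QD q1 q10.
have [d d0 dQ] := Qnear q1 q10.
have [lP lP0 densP] := Pdense p1 p10.
have [lQ lQ0 densQ] := Qdense q2 q20.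
pose l := Num.max lP lQ.
have l0 : 0 < l by rewrite lt_max lP0.
pose valid (st : R * R) := [/\ P p1 st.1, Q q2 st.2 & `|st.1 - st.2| <= l].
(* The shift by l makes the quotient nonnegative, so that truncation is a floor. *)
pose bucket (st : R * R) := Num.truncn ((st.1 - st.2 + l) / d).
have bound_bucket st : valid st -> (bucket st < (Num.truncn (2 * l / d)).+1)%N.
  move=> [_ _]; rewrite ler_norml => /andP[? ?]; rewrite ltnS; apply: le_truncn.
  by rewrite ler_pM2r ?invr_gt0 //; lra.
have /choice[sg sgP] j : exists st, (exists2 st', valid st' & bucket st' = j) ->
    valid st /\ bucket st = j.
  have [[st' v b]|nex] := pselect (exists2 st', valid st' & bucket st' = j).
    by exists st'.
  by exists (0, 0).
pose M := \sum_(j < (Num.truncn (2 * l / d)).+1) `|(sg j).1|.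
have M0 : 0 <= M by exact: sumr_ge0.
exists (l + 2 * M) => [|a]; first by lra.
(* Starting at a + M, the difference t1 - s1 cannot fall below a. *)
have [t1 [Pt1]] := densP (a + M); rewrite /= in_itv /= => /andP[t1a t1b].
have [t2 [Qt2]] := densQ (a + M); rewrite /= in_itv /= => /andP[t2a t2b].
have lPl : lP <= l by rewrite le_max lexx.
have lQl : lQ <= l by rewrite le_max lexx orbT.
have vt : valid (t1, t2) by split => //=; rewrite ler_norml; apply/andP; split; lra.
have jm := bound_bucket _ vt.
have [[Ps Qs sl] bs] := sgP _ (ex_intro2 _ _ _ vt erefl).
move: jm Ps Qs sl bs; set j := bucket (t1, t2); case sgj: (sg j) => [s1 s2] /=.
move=> jm Ps Qs sl bs.
have s1M : `|s1| <= M.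
  rewrite /M (bigD1 (Ordinal jm)) //= sgj /= lerDl; exact: sumr_ge0.
move: s1M; rewrite ler_norml => /andP[? ?].
exists (t1 - s1); split; last by rewrite /= in_itv /=; apply/andP; split; lra.
split; first by apply: PP => //; exact: PN.
rewrite (_ : t1 - s1 = (t2 - s2) + ((t1 - t2) - (s1 - s2))); last by ring.
apply: QQ; first by apply: QQ1 => //; exact: QN.
apply: dQ.
have vl : `|t1 - t2| <= l by case: vt.
move: sl vl; rewrite !ler_norml => /andP[? ?] /andP[? ?].
have A0 : 0 <= (t1 - t2 + l) / d by apply: divr_ge0; lra.
have B0 : 0 <= (s1 - s2 + l) / d by apply: divr_ge0; lra.
have := same_truncn_dist _ _ A0 B0 (esym bs).
rewrite -mulrBl normrM (gtr0_norm (_ : 0 < d^-1)) ?invr_gt0 // ler_pdivrMr // mul1r.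
rewrite (_ : t1 - t2 + l - (s1 - s2 + l) = t1 - t2 - (s1 - s2)); last by ring.
by rewrite ler_norml.
Qed.

Lemma bohr_familyI P Q : bohr_family P -> bohr_family Q ->
  bohr_family (fun c => P c `&` Q c).
Proof.
move=> bP bQ; have [Ple PN PD Pnear _] := bP; have [Qle QN QD Qnear _] := bQ.
split.
- by move=> c1 c2 c12; apply: setISS; [exact: Ple|exact: Qle].
- by move=> c t [Pt Qt]; split; [exact: PN|exact: QN].
- move=> c c0; have [p p0 PP] := PD c c0; have [q q0 QQ] := QD c c0.
  have pm : Num.min p q <= p by rewrite ge_min lexx.
  have qm : Num.min p q <= q by rewrite ge_min lexx orbT.
  exists (Num.min p q); first by rewrite lt_min p0.
  move=> s t [Ps Qs] [Pt Qt]; split.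
    by apply: PP; [exact: Ple pm _ Ps|exact: Ple pm _ Pt].
  by apply: QQ; [exact: Qle qm _ Qs|exact: Qle qm _ Qt].
- move=> c c0; have [p p0 PP] := Pnear c c0; have [q q0 QQ] := Qnear c c0.
  exists (Num.min p q); first by rewrite lt_min p0.
  by move=> s; rewrite le_min => /andP[? ?]; split; [exact: PP|exact: QQ].
- by move=> c c0; exact: bohr_familyI_dense.
Qed.

Lemma bohr_family_forall (P : nat -> R -> set R) n : (forall i, bohr_family (P i)) ->
  bohr_family (fun c => [set t | forall i, (i < n)%N -> P i c t]).
Proof.
move=> bP; elim: n => [|n IH].
  split => //.
  - by move=> c _; exists 1.
  - by move=> c _; exists 1.
  - by move=> c _; exists 1 => // a; exists a; split => //=; rewrite in_itv /= lexx; lra.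
rewrite (_ : (fun c => _) =
  fun c => [set t | forall i, (i < n)%N -> P i c t] `&` P n c); first exact: bohr_familyI.
apply/funext => c; apply/seteqP; split => t /=.
  by move=> H; split => [i i_n|]; apply: H => //; exact: ltnW.
by move=> [H Pn] i; rewrite ltnS leq_eqVlt => /predU1P[->//|]; exact: H.
Qed.

Lemma bohr_family_stepanov (E : completeMetricType R) p (w : R -> E) :
  1 <= p -> stepanov_ap p w -> bohr_family (almost_period p w).
Proof.
move=> p1 wap; have p0 : 0 < p by lra.
have mw := wap.1.1; split.
- by move=> c1 c2; exact: le_almost_period.
- by move=> c t; exact: almost_periodN.
- move=> c c0; have K0 : 0 < 2 `^ p by rewrite powR_gt0.
  exists (c / (2 * 2 `^ p)); first by rewrite divr_gt0 // mulr_gt0.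
  move=> s t ws wt; have := almost_periodD p w _ _ _ _ (ltW p0) mw ws wt.
  by apply: le_almost_period; rewrite le_eqVlt; apply/orP; left; apply/eqP; field; lra.
- by move=> c c0; exact: almost_period_near0.
- by move=> c c0; exact: stepanov_ap_dense.
Qed.

End bohr_families.

(** * Bounds on segments and Young's inequality *)

Section segment_bounds.
Context {R : realType}.
Local Open Scope classical_set_scope.
Local Open Scope ring_scope.
Implicit Types (k l : R -> R) (a b c p q r s t : R).

(** Packs what monotonicity and additivity of integrals ask for, so that a bound on a
    compound integrand can be assembled term by term. *)
Definition segbound a b k c := [/\ lebesgue_measurable k, forall t, 0 <= k t &
  (segint a b k <= c%:E)%E].

Lemma segboundD a b k l (c1 c2 : R) : segbound a b k c1 -> segbound a b l c2 ->
  segbound a b (fun t => k t + l t) (c1 + c2).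
Proof.
move=> [mk k0 kc] [ml l0 lc]; split.
- exact: lebesgue_measurableD.
- by move=> t; exact: addr_ge0.
- by rewrite (segintD a b _ _ mk ml k0 l0) EFinD; exact: leeD.
Qed.

Lemma segboundZ a b k (s c : R) : 0 <= s -> segbound a b k c ->
  segbound a b (fun t => s * k t) (s * c).
Proof.
move=> s0 [mk k0 kc]; split.
- exact: lebesgue_measurableM (lebesgue_measurable_cst s) mk.
- by move=> t; exact: mulr_ge0.
- by rewrite (segintZ a b _ _ mk s0 k0) EFinM; apply: lee_wpmul2l.
Qed.

Lemma segbound_sum a b (k : nat -> R -> R) n c : a <= b ->
  (forall i, (i < n)%N -> segbound a b (k i) c) ->
  segbound a b (fun t => \sum_(i < n) k i t) (n%:R * c).
Proof.
move=> ab; elim: n => [|n IH] kc.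
  have -> : (fun t => \sum_(i < 0) k i t) = fun=> 0.
    by apply/funext => t; rewrite big_ord0.
  split => //; first exact: lebesgue_measurable_cst.
  by rewrite segint_cst // !mul0r.
have -> : (fun t => \sum_(i < n.+1) k i t) = fun t => \sum_(i < n) k i t + k n t.
  by apply/funext => t; rewrite big_ord_recr.
rewrite -natr1 mulrDl mul1r; apply: segboundD; last exact: kc.
by apply: IH => i i_n; apply: kc; exact: ltnW.
Qed.

Lemma segint_le_bound a b k l c : lebesgue_measurable k -> (forall t, 0 <= k t) ->
  (forall t, k t <= l t) -> segbound a b l c -> (segint a b k <= c%:E)%E.
Proof. by move=> mk k0 kl [ml _ lc]; apply: le_trans lc; exact: le_segint. Qed.

(** Young's inequality for a^p and b^p with the conjugate exponents r/p and q/p. *)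
Lemma young_powR p q r a b : 0 < p -> 0 < q -> 0 < r -> p^-1 = q^-1 + r^-1 ->
  0 <= a -> 0 <= b -> (a * b) `^ p <= a `^ r + b `^ q.
Proof.
move=> p0 q0 r0 pqr a0 b0.
have rp0 : 0 < r / p by rewrite divr_gt0.
have qp0 : 0 < q / p by rewrite divr_gt0.
have conj1 : (r / p)^-1 + (q / p)^-1 = 1.
  by rewrite !invf_div -mulrDr addrC -pqr divff // gt_eqF.
have le1 x y : 0 <= x -> 0 < y -> y^-1 <= 1 -> x / y <= x.
  by move=> x0 y0 y1; rewrite -[leRHS]mulr1 ler_wpM2l.
have := @conjugate_powR R (a `^ p) (b `^ p) (r / p) (q / p) (powR_ge0 _ _) (powR_ge0 _ _)
  rp0 qp0 conj1.
rewrite powRM // -!powRrM !(mulrC p) !divfK ?gt_eqF // => /le_trans; apply.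
have := rp0; rewrite -invr_gt0 => rp1; have := qp0; rewrite -invr_gt0 => qp1.
by apply: lerD; apply: le1; rewrite ?powR_ge0 //; lra.
Qed.

Lemma stepanov_bounded_segint (L : R -> R) r : 0 < r -> stepanov_bounded r L ->
  exists2 M, 0 < M & forall a, (segint a (a + 1) (fun t => (`|L t| `^ r)%R) <= M%:E)%E.
Proof.
move=> r0 [mL]; set S := ereal_sup _ => Sfin.
have I0 a : (0 <= segint a (a + 1) (fun t => (`|L t| `^ r)%R))%E.
  by apply: segint_ge0 => t; exact: powR_ge0.
have leS a : (poweR (segint a (a + 1) (fun t => (`|L t| `^ r)%R)) r^-1 <= S)%E.
  by apply: ereal_sup_ubound; exists a.
have S0 : (0 <= S)%E by apply: le_trans (leS 0); exact: poweR_ge0.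
have SE : S = (fine S)%:E by rewrite fineK // ge0_fin_numE.
exists (fine S `^ r + 1); first by rewrite ltr_pwDr // powR_ge0.
move=> a; have := leS a; rewrite SE => aS.
have := @gt0_ler_poweR R r (ltW r0) _ _ _ _ aS.
rewrite -poweRrM mulVf ?gt_eqF // poweRe1 // poweR_EFin => H.
apply: (le_trans (H _ _)).
- by rewrite in_itv /= poweR_ge0 leey.
- by rewrite in_itv /= -SE S0 leey.
- by rewrite lee_fin lerDl.
Qed.

Lemma segint_cat_le a b k : lebesgue_measurable k -> (forall t, 0 <= k t) -> a <= b ->
  (segint a (b + 1) k <= segint a b k + segint b (b + 1) k)%E.
Proof.
move=> mk k0 ab.
have mk' D : @measurable_fun _ _ (lebesgueR R) _ D (fun t => (k t)%:E).
  by apply/measurable_EFinP; exact: measurable_funTS.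
have le_tail : (\int[@completed_lebesgue_measure R]_(t in `]b, (b + 1)%R]) (k t)%:E <=
    segint b (b + 1) k)%E.
  apply: ge0_subset_integral; [exact: lebesgueR_itv|exact: lebesgueR_itv|exact: mk'| |].
    by move=> t _; rewrite lee_fin.
  by move=> t /=; rewrite !in_itv /= => /andP[? ?]; apply/andP; split; lra.
apply: (@le_trans _ _ (segint a b k + \int[@completed_lebesgue_measure R]_(t in `]b, (b + 1)%R]) (k t)%:E)%E).
  rewrite /segint -(@ge0_integral_setU _ (lebesgueR R) R (@completed_lebesgue_measure R)
    `[a, b]%classic `]b, b + 1]%classic (lebesgueR_itv _) (lebesgueR_itv _) (fun t => (k t)%:E)).
  - apply: ge0_subset_integral; [exact: lebesgueR_itv| |exact: mk'| |].
    + by apply: measurableU; exact: lebesgueR_itv.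
    + by move=> t _; rewrite lee_fin.
    move=> t /=; rewrite !in_itv /= => /andP[ta tb].
    by have [tb'|tb'] := leP t b; [left|right]; rewrite ?ta.
  - exact: mk'.
  - by move=> t _; rewrite lee_fin.
  - apply/disj_setPS => t [] /=; rewrite !in_itv /= => /andP[_ tb] /andP[bt _].
    by have := lt_le_trans bt tb; rewrite ltxx.
exact: leeD.
Qed.

Lemma segint_unit_bounded k (M a b : R) : lebesgue_measurable k -> (forall t, 0 <= k t) ->
  (forall a, (segint a (a + 1) k <= M%:E)%E) -> (segint a b k < +oo)%E.
Proof.
move=> mk k0 kM.
(* One unit more than needed, so that the case n = 0 is covered as well. *)
have H n : (segint a (a + n%:R) k <= (n.+1%:R * M)%:E)%E.
  elim: n => [|n IH].
    rewrite addr0 mul1r; apply: le_trans (kM a); apply: (segintS _ _ _ _ _ mk k0); lra.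
  rewrite -natr1 addrA; apply: le_trans (segint_cat_le _ _ _ mk k0 _) _.
    by rewrite lerDl.
  by rewrite -natr1 mulrDl mul1r EFinD; apply: leeD.
apply: le_lt_trans (ltry _).
apply: le_trans (H (Num.truncn `|b - a|).+1); apply: (segintS _ _ _ _ _ mk k0) => //.
have := truncnS_gt `|b - a|; have := ler_norm (b - a); lra.
Qed.

End segment_bounds.

(** * Superposition *)

Section superposition.
Context {R : realType} {E : completeMetricType R}.
Local Open Scope classical_set_scope.
Local Open Scope ring_scope.
Local Notation mu := (@completed_lebesgue_measure R).
Local Notation bm w := (lebesgue_measurable (w : R -> borel E)).
Context (p q r : R) (hp : 1 <= p) (hq : 1 <= q) (hr : 1 <= r).
Context (hpqr : p^-1 = q^-1 + r^-1) (f : R * E -> E) (L : R -> R) (u : R -> E).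
Context (hf : stepanov_ap_param p f) (hL : stepanov_bounded r L).
Context (L0 : forall t, 0 <= L t) (hu : stepanov_ap q u).
Context (lip : forall t x y, mdist (f (t, x)) (f (t, y)) <= L t * mdist x y).

Let p0 : 0 < p. Proof. by move: hp; lra. Qed.
Let q0 : 0 < q. Proof. by move: hq; lra. Qed.
Let r0 : 0 < r. Proof. by move: hr; lra. Qed.
Let meas_u : bm u. Proof. exact: hu.1.1. Qed.
Let mL : lebesgue_measurable L. Proof. exact: hL.1. Qed.
Let v t := f (t, u t).
Let sec x t := f (t, x).

Let mv : bm v.
Proof.
have mid : @measurable_fun _ _ (lebesgueR R) (lebesgueR R) setT idfun.
  exact: measurable_id.
exact: (@measurableT_comp _ _ _ (lebesgueR R) (lebesgueR R * borel E)%type (borel E)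
  f setT (fun t => (t, u t)) hf.1 (measurable_fun_pair mid meas_u)).
Qed.

Let msec x : bm (sec x). Proof. exact: (hf.2 x).1.1. Qed.

(** Compare v with the section of f at one point z: the difference is at most
    L(t) d(u(t), z), whose p-th power is bounded by L^r + d(u, z)^q. *)
Lemma superposition_locally_integrable : locally_integrable_pow p v.
Proof.
have mc x : bm (fun=> x) by exact: (@measurable_cst _ _ (lebesgueR R) (borel E)).
split; first exact: mv.
pose z := u 0; exists z => a b _.
have [M M0 LM] := stepanov_bounded_segint L r r0 hL.
pose A t := `|L t| `^ r; pose B := dist_pow q u (fun=> z).
have mA : lebesgue_measurable A.
  apply: lebesgue_measurable_pow.
  exact: (@measurableT_comp _ _ _ (lebesgueR R) R R _ _ _ (@normr_measurable R setT) mL).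
have A0 t : 0 <= A t by exact: powR_ge0.
have Afin : (segint a b A < +oo)%E by exact: segint_unit_bounded LM.
have mB : lebesgue_measurable B by exact: measurable_dist_pow.
have B0 t : 0 <= B t by exact: dist_pow_ge0.
have Bfin : (segint a b B < +oo)%E by apply: locally_integrable_dist (ltW q0) hu.1.
have Cfin : (segint a b (dist_pow p (sec z) (fun=> z)) < +oo)%E.
  exact: locally_integrable_dist (ltW p0) (hf.2 z).1.
have finE k : (forall t, 0 <= k t) -> (segint a b k < +oo)%E ->
    (segint a b k <= (fine (segint a b k))%:E)%E.
  by move=> k0 kfin; rewrite fineK // ge0_fin_numE //; exact: segint_ge0.
pose c := fine (segint a b A) + fine (segint a b B).
have AB : segbound a b (fun t => A t + B t) c.
  by apply: segboundD; split => //; exact: finE.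
have vsec : (segint a b (dist_pow p v (sec z)) <= c%:E)%E.
  apply: (segint_le_bound _ _ _ _ _ (measurable_dist_pow p _ _ mv (msec z))
    (dist_pow_ge0 p _ _) _ AB).
  move=> t; apply: le_trans (young_powR p q r _ _ p0 q0 r0 hpqr (normr_ge0 _) (mdist_ge0 _ _)).
  by apply: le_powR; [exact: ltW|exact: mdist_ge0|rewrite ger0_norm //; exact: lip].
apply: le_lt_trans (ltry _).
have secC := finE _ (fun t => dist_pow_ge0 p (sec z) (fun=> z) t) Cfin.
exact: (segint_dist_pow_triangle p v (sec z) (fun=> z) _ _ _ _ (ltW p0) mv (msec z) (mc z)
  vsec secC).
Qed.

(** The estimate that drives the proof. The parameter lm weighs L against the distances
    in Young's inequality. *)
Lemma superposition_pointwise (x : nat -> E) n t tau (lm : R) : 0 < lm ->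
  dist_pow p (translate v tau) v t <=
  2 `^ p * ((lm `^ r * L (t + tau) `^ r +
             lm^-1 `^ q * (2 `^ q * (dist_pow q (translate u tau) u t + net_dist x n (u t) `^ q))) +
            2 `^ p * ((lm `^ r * L t `^ r + lm^-1 `^ q * net_dist x n (u t) `^ q) +
                      \sum_(i < n.+1) dist_pow p (translate (sec (x i)) tau) (sec (x i)) t)).
Proof.
move=> lm0.
have [i i_n ui] := net_distP x n (u t).
have m0 := net_dist_ge0 x n (u t).
have young a b : 0 <= a -> 0 <= b -> (a * b) `^ p <= lm `^ r * a `^ r + lm^-1 `^ q * b `^ q.
  move=> a0 b0; rewrite -powRM ?(ltW lm0) // -powRM ?invr_ge0 ?(ltW lm0) //.
  rewrite (_ : a * b = (lm * a) * (lm^-1 * b)); last by field; rewrite gt_eqF.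
  apply: young_powR => //; first by rewrite mulr_ge0 // ltW.
  by rewrite mulr_ge0 // invr_ge0 ltW.
have K0 : 0 <= 2 `^ p by exact: powR_ge0.
apply: le_trans (dist_pow_triangle p _ (fun t => f (t + tau, x i)) _ t (ltW p0)) _.
rewrite ler_wpM2l // lerD //.
  rewrite /dist_pow /translate /v.
  apply: (@le_trans _ _ ((L (t + tau) * (mdist (u (t + tau)) (u t) + net_dist x n (u t))) `^ p)).
    apply: le_powR; [exact: ltW|exact: mdist_ge0|].
    apply: le_trans (lip _ _ _) _; rewrite ler_wpM2l // ui; exact: mdist_triangle.
  apply: le_trans (young _ _ (L0 _) (addr_ge0 (mdist_ge0 _ _) m0)) _.
  rewrite lerD2l ler_wpM2l ?powR_ge0 //.
  exact: powRD_le (ltW q0) (mdist_ge0 _ _) m0.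
apply: le_trans (dist_pow_triangle p _ (sec (x i)) _ t (ltW p0)) _.
rewrite ler_wpM2l // addrC lerD //.
  rewrite /dist_pow /sec /v; apply: le_trans (young _ _ (L0 t) m0).
  apply: le_powR; [exact: ltW|exact: mdist_ge0|].
  by apply: le_trans (lip _ _ _) _; rewrite mdistC ui.
rewrite (bigD1 (inord i)) //= inordK // lerDl; apply: sumr_ge0 => j _.
exact: dist_pow_ge0.
Qed.

Lemma superposition_almost_periods c : 0 < c -> relatively_dense (almost_period p v c).
Proof.
move=> c0.
have [M M0 LM] := stepanov_bounded_segint L r r0 hL.
pose K := 2 `^ p; have K0 : 0 < K by rewrite powR_gt0.
pose Kq := 2 `^ q; have Kq0 : 0 < Kq by rewrite powR_gt0.
have KK0 : 0 < K + K * K by rewrite addr_gt0 // mulr_gt0.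
(* The final bound is a sum of four terms: one from L, and one for each of the
   tolerances al (for u), de (for the net) and be (for the sections of f). The
   tolerances are chosen so that every term equals c / 4. *)
pose eta := c / (4 * (K + K * K)).
have eta0 : 0 < eta by rewrite divr_gt0 // mulr_gt0.
(* Then lm^r L^r has integral at most eta over each unit segment. *)
pose lm := (eta / M) `^ r^-1.
have etaM0 : 0 < eta / M by rewrite divr_gt0.
have lm0 : 0 < lm by rewrite powR_gt0.
have lmr : lm `^ r = eta / M.
  by rewrite /lm -powRrM mulVf ?gt_eqF // powRr1 // ltW.
pose C := lm^-1 `^ q; have C0 : 0 < C by rewrite powR_gt0 // invr_gt0.
pose al := c / (4 * (K * (C * Kq))).
have KCKq0 : 0 < K * (C * Kq) by rewrite !mulr_gt0.
have al0 : 0 < al by rewrite divr_gt0 // mulr_gt0.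
have KKC0 : 0 < K * K * C by rewrite !mulr_gt0.
pose de := c / (4 * (K * (C * Kq) + K * K * C)).
have DD0 : 0 < K * (C * Kq) + K * K * C by rewrite addr_gt0.
have de0 : 0 < de by rewrite divr_gt0 // mulr_gt0.
have [x xu] := ess_separable u meas_u.
have [n netn] := uniform_net q u x de hq hu xu de0.
have nn0 : 0 < n.+1%:R :> R by rewrite ltr0Sn.
pose be := c / (4 * (K * K * n.+1%:R)).
have KKn0 : 0 < K * K * n.+1%:R by rewrite !mulr_gt0.
have be0 : 0 < be by rewrite divr_gt0 // mulr_gt0.
have bsec : bohr_family (fun c => [set t | forall i, (i < n.+1)%N ->
    almost_period p (sec (x i)) c t]).
  by apply: bohr_family_forall => i; apply: bohr_family_stepanov => //; exact: hf.2.
have bu := bohr_family_stepanov E q u hq hu.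
have mn0 : 0 < Num.min al be by rewrite lt_min al0.
have [l l0 lP] := bohr_familyI_dense _ _ _ bu bsec mn0.
exists l => // a; have [tau [[utau sectau] tauI]] := lP a.
exists tau; split => // {tauI a} a.
have mt w : bm w -> bm (translate w tau) by move=> mw; exact: measurable_translate.
have aa : a <= a + 1 by lra.
pose Lr t := L t `^ r.
have LrE t : Lr t = `|L t| `^ r by rewrite ger0_norm.
have mLr : lebesgue_measurable Lr by exact: lebesgue_measurable_pow.
have Lr0 t : 0 <= Lr t by exact: powR_ge0.
have bL b : segbound b (b + 1) Lr M.
  split => //; have := LM b; apply: eq_segint_le => t; exact/esym/LrE.
have bLt : segbound a (a + 1) (fun t => Lr (t + tau)) M.
  split; [exact: lebesgue_measurable_shift|by move=> t; exact: Lr0|].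
  rewrite segint_shift // addrAC; have [_ _ H] := bL (a + tau); exact: H.
have bm_ : segbound a (a + 1) (fun t => net_dist x n (u t) `^ q) de.
  split; [|by move=> t; exact: powR_ge0|exact: netn].
  by apply: lebesgue_measurable_pow; exact: measurable_net_dist.
have bD : segbound a (a + 1) (dist_pow q (translate u tau) u) al.
  split; [apply: measurable_dist_pow => //; exact: mt|by move=> t; exact: dist_pow_ge0|].
  by apply: le_trans (utau a) _; rewrite lee_fin ge_min lexx.
have bS : segbound a (a + 1)
    (fun t => \sum_(i < n.+1) dist_pow p (translate (sec (x i)) tau) (sec (x i)) t)
    (n.+1%:R * be).
  apply: (segbound_sum _ _ (fun i => dist_pow p (translate (sec (x i)) tau) (sec (x i)))) => // i i_n.
  split; [apply: measurable_dist_pow => //; exact: mt|by move=> t; exact: dist_pow_ge0|].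
  by apply: le_trans (sectau i i_n a) _; rewrite lee_fin ge_min lexx orbT.
have B := segboundZ _ _ _ _ _ (ltW K0) (segboundD _ _ _ _ _ _
  (segboundD _ _ _ _ _ _ (segboundZ _ _ _ _ _ (powR_ge0 lm r) bLt)
    (segboundZ _ _ _ _ _ (ltW C0) (segboundZ _ _ _ _ _ (ltW Kq0) (segboundD _ _ _ _ _ _ bD bm_))))
  (segboundZ _ _ _ _ _ (ltW K0) (segboundD _ _ _ _ _ _
    (segboundD _ _ _ _ _ _ (segboundZ _ _ _ _ _ (powR_ge0 lm r) (bL a))
      (segboundZ _ _ _ _ _ (ltW C0) bm_)) bS))).
have := segint_le_bound _ _ _ _ _ (measurable_dist_pow p _ _ (mt _ mv) mv)
  (dist_pow_ge0 p _ _) (fun t => superposition_pointwise x n t tau lm lm0) B.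
move/le_trans; apply; rewrite lee_fin lmr divfK ?gt_eqF //.
have e1 : (K + K * K) * eta = c / 4 by rewrite /eta; field; rewrite gt_eqF.
have e2 : K * (C * Kq) * al = c / 4 by rewrite /al; field; rewrite !gt_eqF.
have e3 : (K * (C * Kq) + K * K * C) * de = c / 4 by rewrite /de; field; rewrite gt_eqF.
have e4 : K * K * n.+1%:R * be = c / 4.
  by rewrite /be; move: (n.+1%:R : R) nn0 => k k0; field; rewrite !gt_eqF.
rewrite le_eqVlt; apply/orP; left; apply/eqP.
transitivity (((K + K * K) * eta + K * (C * Kq) * al +
  (K * (C * Kq) + K * K * C) * de) + K * K * n.+1%:R * be); first by ring.
by rewrite e1 e2 e3 e4; field.
Qed.

End superposition.

Theorem theorem2p10 (R : realType) (E : completeMetricType R) (p q r : R)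
    (hp : 1 <= p) (hq : 1 <= q) (hr : 1 <= r)
    (hpqr : p^-1 = q^-1 + r^-1)
    (f : R * E -> E) (hf : stepanov_ap_param p f)
    (hL : exists L : R -> R,
      [/\ stepanov_bounded r L,
          forall t : R, 0 <= L t
        & forall (t : R) (u v : E),
            mdist (f (t, u)) (f (t, v)) <= L t * mdist u v])
    (u : R -> E) (hu : stepanov_ap q u) :
  stepanov_ap p (fun t : R => f (t, u t)).
Proof.
have [L [Lr L0 lip]] := hL.
apply: stepanov_ap_of_dense; first exact: lt_le_trans hp.
  exact: (superposition_locally_integrable p q r hp hq hr hpqr f L u hf Lr L0 hu lip).
move=> c c0.
exact: (superposition_almost_periods p q r hp hq hr hpqr f L u hf Lr L0 hu lip c c0).
Qed.
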